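(* Let $0<r_1<r_2<\infty$. (a) Let $\phi:\{r_1,r_2\}\times\mathbb{R}\to\mathbb{R}$ be continuous, $2\pi$-periodic in the second variable, and satisfy $\int_0^{2\pi} r_1\phi(r_1,\theta)\,d\theta=\int_0^{2\pi} r_2\phi(r_2,\theta)\,d\theta$. If $U$ is the solution of the polar Neumann problem with boundary data $\phi$ satisfying $U(\sqrt{r_1r_2},0)=0$, then for every $(r,\theta)\in[r_1,r_2]\times\mathbb{R}$ $$U(r,\theta)=\int_{\frac{\sqrt{r_1r_2}}{r}}^{1}\frac{u(r\rho,\theta)}{\rho}\,d\rho+\sqrt{r_1r_2}\int_0^{\theta}\left(\mathcal{C}-\int_0^t u_r(\sqrt{r_1r_2},\tau)\,d\tau\right)dt,$$ where $u$ is the solution of the polar Dirichlet problem with boundary values $\varphi(r,\theta)=r\phi(r,\theta)$ on $\{r_1,r_2\}\times\mathbb{R}$ and $$\mathcal{C}=\frac{\sqrt{r_1r_2}}{2\pi}\int_0^{2\pi}\int_0^t u_r(\sqrt{r_1r_2},\tau)\,d\tau\,dt.$$ (b) Conversely, let $\varphi:\{r_1,r_2\}\times\mathbb{R}\to\mathbb{R}$ be continuous, $2\pi$-periodic in the second variable, and satisfy $\int_0^{2\pi}\varphi(r_1,\theta)\,d\theta=\int_0^{2\pi}\varphi(r_2,\theta)\,d\theta$. If $U$ is a solution of the polar Neumann problem with boundary data $\phi(r,\theta)=\varphi(r,\theta)/r$ for $(r,\theta)\in\{r_1,r_2\}\times\mathbb{R}$, then $$u(r,\theta)=rU_r(r,\theta),\qquad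 (r,\theta)\in[r_1,r_2]\times\mathbb{R},$$ is the solution of the polar Dirichlet problem with boundary data $\varphi$.
   Context: Polar Dirichlet problem with data $\varphi$: find $u\in C^2((r_1,r_2)\times\mathbb{R})\cap C^0([r_1,r_2]\times\mathbb{R})$, $2\pi$-periodic in the second variable $\theta$, with $u_{rr}+\frac1r u_r+\frac1{r^2}u_{\theta\theta}=0$ in $(r_1,r_2)\times\mathbb{R}$ and $u=\varphi$ on $\{r_1,r_2\}\times\mathbb{R}$. Polar Neumann problem with data $\phi$: find $U\in C^2((r_1,r_2)\times\mathbb{R})\cap C^1([r_1,r_2]\times\mathbb{R})$, $2\pi$-periodic in $\theta$, with $U_{rr}+\frac1r U_r+\frac1{r^2}U_{\theta\theta}=0$ in $(r_1,r_2)\times\mathbb{R}$ and $U_r=\phi$ on $\{r_1,r_2\}\times\mathbb{R}$. Here $C^1$ on a closed set means that the first order partial derivatives extend continuously to the closed set; subscripts denote partial derivatives.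
   Formalization: The constant C is taken as (1/2π)∫₀^{2π}∫₀^t u_r(√(r₁r₂),τ)dτdt, without the printed extra factor √(r₁r₂); as printed the formula fails for r₁=1, r₂=4, U=u=r sin θ. *)

(* Defs.v *)
(* Stdlib reals with Coquelicot. *)
From Stdlib Require Import Reals Lra.
From Coquelicot Require Import Coquelicot.
Open Scope R_scope.

(* Functions on a strip or on its boundary lines are total functions of
   (r, theta).  Every predicate below depends only on the values taken on the
   set in question: [r1, r2] x R, (r1, r2) x R or {r1, r2} x R. *)

Definition closed_strip (r1 r2 : R) (p : R * R) : Prop := r1 <= fst p <= r2.

(* Continuity relative to the closed strip, hence one-sided in r at the
   boundary lines. *)
Definition C0_closed (r1 r2 : R) (f : R -> R -> R) : Prop :=
  continuous_on (closed_strip r1 r2) (fun p : R * R => f (fst p) (snd p)).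

Definition C2_open (r1 r2 : R) (f : R -> R -> R) : Prop :=
  forall r theta, r1 < r < r2 -> ex_diff_n f 2 r theta.

Definition d_r (f : R -> R -> R) (r theta : R) : R :=
  Derive (fun x => f x theta) r.

Definition d_theta (f : R -> R -> R) (r theta : R) : R :=
  Derive (fun t => f r t) theta.

(* g is the continuous extension to the closed strip of f, which is only
   considered on the open strip; it is unique on the closed strip. *)
Definition extends_to (r1 r2 : R) (f g : R -> R -> R) : Prop :=
  C0_closed r1 r2 g /\
  (forall r theta, r1 < r < r2 -> g r theta = f r theta).

Definition C1_closed (r1 r2 : R) (f : R -> R -> R) : Prop :=
  C0_closed r1 r2 f /\
  (exists fr, extends_to r1 r2 (d_r f) fr) /\
  (exists ft, extends_to r1 r2 (d_theta f) ft).

Definition periodic_strip (r1 r2 : R) (f : R -> R -> R) : Prop :=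
  forall r theta, r1 <= r <= r2 -> f r (theta + 2 * PI) = f r theta.

Definition polar_laplace (r1 r2 : R) (f : R -> R -> R) : Prop :=
  forall r theta, r1 < r < r2 ->
    d_r (d_r f) r theta + / r * d_r f r theta
      + / (r ^ 2) * d_theta (d_theta f) r theta = 0.

Definition eq_on_boundary (r1 r2 : R) (f g : R -> R -> R) : Prop :=
  forall r theta, r = r1 \/ r = r2 -> f r theta = g r theta.

(* {r1, r2} x R is a disjoint union of two lines, so continuity on it is
   continuity in theta on each line. *)
Definition boundary_data (r1 r2 : R) (phi : R -> R -> R) : Prop :=
  forall r, r = r1 \/ r = r2 ->
    (forall theta, continuous (phi r) theta) /\
    (forall theta, phi r (theta + 2 * PI) = phi r theta).

Definition dirichlet_solution (r1 r2 : R) (phi u : R -> R -> R) : Prop :=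
  C2_open r1 r2 u /\ C0_closed r1 r2 u /\ periodic_strip r1 r2 u /\
  polar_laplace r1 r2 u /\ eq_on_boundary r1 r2 u phi.

Definition the_dirichlet_solution (r1 r2 : R) (phi u : R -> R -> R) : Prop :=
  dirichlet_solution r1 r2 phi u /\
  (forall v, dirichlet_solution r1 r2 phi v ->
     forall r theta, r1 <= r <= r2 -> v r theta = u r theta).

(* On the boundary U_r is the continuous extension of the interior derivative. *)
Definition neumann_solution (r1 r2 : R) (phi U : R -> R -> R) : Prop :=
  C2_open r1 r2 U /\ C1_closed r1 r2 U /\ periodic_strip r1 r2 U /\
  polar_laplace r1 r2 U /\
  (exists Ur, extends_to r1 r2 (d_r U) Ur /\ eq_on_boundary r1 r2 Ur phi).

(* The mean over a period of t |-> int_0^t u_r(s, tau) dtau.  There is no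
   further factor s: with it the representation of U would not be 2 pi-periodic
   (for u = U = r sin theta, the mean must be 1). *)
Definition mean_const (s : R) (u : R -> R -> R) : R :=
  / (2 * PI) *
  RInt (fun t => RInt (fun tau => d_r u s tau) 0 t) 0 (2 * PI).

(* Main.v *)
(* In the variable x = ln r the polar Laplace equation becomes u_xx + u_tt = 0, and
   r U_r becomes the x-derivative of U.  So r U_r is harmonic with boundary values
   r phi as soon as it is C2, and the maximum principle identifies it with u.  The
   missing derivative of the C2 function U comes from comparison: the odd part of a
   harmonic function lies below an explicit quadratic barrier, which bounds the
   gradient by the sup norm, and applying this bound to difference quotients bounds
   the second derivatives.  Hence the difference quotients of U in x, which are
   harmonic and converge locally uniformly to U_x, converge in C2.  Given
   u = r U_r, the formula for U is two applications of the fundamental theorem of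
   calculus: along the radius from s = sqrt (r1 r2), and twice along the circle r = s,
   where U_tt = - s u_r. *)
Require Import Defs.
From Stdlib Require Import Reals Lra Lia ClassicalEpsilon.
From Coquelicot Require Import Coquelicot.
Open Scope R_scope.

(** * The maximum principle *)

(** The logarithmic variable does more than simplify the equation. The polar operator is not
    invariant under translations in r, whereas the Cartesian Laplacian is invariant under
    translations in x, and this is what makes difference quotients of solutions solutions again. All
    the analysis rests on the second derivative test at a maximum. The derivative estimates drawn
    from it are linear in the sup norm, so they apply to the difference of two members of a
    sequence: a uniformly Cauchy sequence of harmonic functions is then Cauchy together with its
    first and second derivatives. The constants are not sharp; only their form matters. A second
    obstacle is the boundary. There u and U_r are known only through continuity relative to the
    closed strip, with no equation and no second derivatives. Interior arguments therefore concern
    jets, and boundary values enter through a separate continuous function that agrees with the jet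
    inside. *)

Lemma continuity_2d_pt_comp (f g h : R -> R -> R) (x y : R) :
  continuity_2d_pt f (g x y) (h x y) ->
  continuity_2d_pt g x y -> continuity_2d_pt h x y ->
  continuity_2d_pt (fun u v => f (g u v) (h u v)) x y.
Proof.
  intros Hf Hg Hh eps.
  destruct (Hf eps) as [d Hd].
  destruct (Hg d) as [d1 Hd1].
  destruct (Hh d) as [d2 Hd2].
  assert (Hm : 0 < Rmin d1 d2) by (apply Rmin_pos; apply cond_pos).
  exists (mkposreal _ Hm); simpl; intros u v Hu Hv.
  apply Hd.
  - apply Hd1; [apply Rlt_le_trans with (1 := Hu) | apply Rlt_le_trans with (1 := Hv)];
      apply Rmin_l.
  - apply Hd2; [apply Rlt_le_trans with (1 := Hu) | apply Rlt_le_trans with (1 := Hv)];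
      apply Rmin_r.
Qed.

(** Precomposition with this retraction makes a function that is continuous only relative to an
    interval or closed strip continuous everywhere, so that two-sided notions such as
    [continuity_2d_pt] apply up to the boundary. *)
Definition clamp (a b x : R) : R := Rmax a (Rmin b x).

Lemma clamp_in (a b x : R) : a <= b -> a <= clamp a b x <= b.
Proof.
  intros Hab; unfold clamp, Rmax, Rmin; destruct (Rle_dec b x);
    destruct (Rle_dec a _); lra.
Qed.

Lemma clamp_id (a b x : R) : a <= x <= b -> clamp a b x = x.
Proof.
  intros Hx; unfold clamp, Rmax, Rmin; destruct (Rle_dec b x);
    destruct (Rle_dec a _); lra.
Qed.

Lemma clamp_lipschitz (a b x y : R) :
  Rabs (clamp a b x - clamp a b y) <= Rabs (x - y).
Proof.
  unfold clamp, Rmax, Rmin; destruct (Rle_dec b x); destruct (Rle_dec b y);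
    repeat destruct (Rle_dec a _); unfold Rabs; repeat destruct (Rcase_abs _); lra.
Qed.

(** The one-dimensional theorem is used twice, on each vertical segment and then on the partial
    maxima [f x (Y x)]. The chosen maximizer [Y] may jump, but the maximal value is continuous by
    uniform continuity of [f]. *)
Lemma extreme_value_2d (f : R -> R -> R) (a b c d : R) :
  a <= b -> c <= d ->
  (forall x y, a <= x <= b -> c <= y <= d -> continuity_2d_pt f x y) ->
  exists x0 y0, a <= x0 <= b /\ c <= y0 <= d /\
    forall x y, a <= x <= b -> c <= y <= d -> f x y <= f x0 y0.
Proof.
  intros Hab Hcd Hf.
  assert (Hy : forall x, exists y0, a <= x <= b ->
             c <= y0 <= d /\ forall y, c <= y <= d -> f x y <= f x y0).
  { intros x.
    destruct (Rle_dec a x) as [Hx1 | Hx1]; [ | exists 0; lra].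
    destruct (Rle_dec x b) as [Hx2 | Hx2]; [ | exists 0; lra].
    destruct (continuity_ab_maj (f x) c d Hcd) as [y0 [H1 H2]].
    - intros y Hyy.
      apply continuity_pt_locally; intros eps.
      destruct (Hf x y (conj Hx1 Hx2) Hyy eps) as [dl Hdl].
      exists dl; intros v Hv; apply Hdl; [ | exact Hv].
      rewrite Rminus_diag, Rabs_R0; apply cond_pos.
    - exists y0; intros _; split; auto. }
  set (Y := fun x => proj1_sig (constructive_indefinite_description _ (Hy x))).
  assert (HY : forall x, a <= x <= b ->
             c <= Y x <= d /\ forall y, c <= y <= d -> f x y <= f x (Y x))
    by (intros x; exact (proj2_sig (constructive_indefinite_description _ (Hy x)))).
  destruct (continuity_ab_maj (fun x => f (clamp a b x) (Y (clamp a b x))) a b Hab)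
    as [x0 [H1 H2]].
  - intros x Hx; apply continuity_pt_locally; intros eps.
    destruct (uniform_continuity_2d f a b c d Hf eps) as [dl Hdl].
    exists dl; intros u Hu.
    assert (Hu' : Rabs (clamp a b u - clamp a b x) < dl)
      by (eapply Rle_lt_trans; [apply clamp_lipschitz | exact Hu]).
    assert (H0 : forall y : R, Rabs (y - y) < dl)
      by (intros; rewrite Rminus_diag, Rabs_R0; apply cond_pos).
    assert (Hbu := clamp_in a b u Hab); assert (Hbx := clamp_in a b x Hab).
    destruct (HY (clamp a b u) Hbu) as [Hu1 Hu2].
    destruct (HY (clamp a b x) Hbx) as [Hx1 Hx2].
    (* Each maximizer is also tested on the other vertical line, which bounds the difference of the
       two maxima from both sides. *)
    pose proof (Hdl _ _ _ _ Hbx Hu1 Hbu Hu1 Hu' (H0 _)) as K1.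
    pose proof (Hdl _ _ _ _ Hbx Hx1 Hbu Hx1 Hu' (H0 _)) as K2.
    pose proof (Hu2 _ Hx1); pose proof (Hx2 _ Hu1).
    apply Rabs_def2 in K1; apply Rabs_def2 in K2.
    apply Rabs_def1; lra.
  - exists x0, (Y x0); destruct (HY x0 H2) as [Hy1 Hy2].
    split; [exact H2 | split; [exact Hy1 | ]].
    intros x y Hx Hyy.
    specialize (H1 x Hx); rewrite (clamp_id a b x Hx), (clamp_id a b x0 H2) in H1.
    eapply Rle_trans; [ | exact H1].
    now apply HY.
Qed.

(** If [l] were positive then, as [f1 x = 0], [f1] would be positive just to the right of [x], and
    [f] would exceed its maximum there. *)
Lemma second_derivative_at_max (f f1 : R -> R) (x l : R) :
  locally x (fun t => is_derive f t (f1 t)) -> is_derive f1 x l ->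
  locally x (fun t => f t <= f x) -> l <= 0.
Proof.
  intros [d1 H1] H2 [d2 H3].
  destruct (Rle_lt_dec l 0) as [Hl | Hl]; [exact Hl | exfalso].
  apply is_derive_Reals in H2.
  destruct (H2 (l / 2)) as [d3 H4]; [lra | ].
  set (d := Rmin d1 (Rmin d2 d3) / 2).
  assert (Hd : 0 < d /\ d < d1 /\ d < d2 /\ d < d3).
  { pose proof (cond_pos d1); pose proof (cond_pos d2); pose proof (cond_pos d3).
    unfold d, Rmin; repeat destruct (Rle_dec _ _); lra. }
  destruct Hd as [Hd [Hd1 [Hd2 Hd3]]].
  assert (Hf1 : forall t, Rabs (t - x) <= d -> derivable_pt_lim f t (f1 t)).
  { intros t Ht; apply is_derive_Reals, H1.
    apply Rle_lt_trans with (1 := Ht); lra. }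
  assert (Hz : f1 x = 0).
  { assert (D : derivable_pt_lim f x (f1 x))
      by (apply Hf1; rewrite Rminus_diag, Rabs_R0; lra).
    pose (pr := exist _ (f1 x) D : derivable_pt f x).
    change (f1 x) with (derive_pt f x pr).
    apply deriv_maximum with (a := x - d) (b := x + d); try lra.
    intros t Ht1 Ht2; apply H3; change (Rabs (t - x) < d2); apply Rabs_def1; lra. }
  destruct (MVT_cor2 f f1 x (x + d)) as [c [Hc1 Hc2]]; [lra | | ].
  { intros t Ht; apply Hf1; apply Rabs_le; lra. }
  assert (Hfx : f (x + d) <= f x).
  { apply H3. change (Rabs (x + d - x) < d2).
    replace (x + d - x) with d by ring; rewrite Rabs_pos_eq; lra. }
  assert (Hc3 : f1 c > 0).
  { specialize (H4 (c - x)).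
    replace (x + (c - x)) with c in H4 by ring.
    assert (Hq : Rabs ((f1 c - f1 x) / (c - x) - l) < l / 2).
    { apply H4; [lra | rewrite Rabs_pos_eq; lra]. }
    apply Rabs_def2 in Hq.
    assert (0 < (f1 c - f1 x) / (c - x)) by lra.
    replace (f1 c) with ((f1 c - f1 x) / (c - x) * (c - x)) by (rewrite Hz; field; lra).
    apply Rmult_lt_0_compat; lra. }
  assert (0 < f1 c * (x + d - x)) by (apply Rmult_lt_0_compat; lra).
  lra.
Qed.

(* Carrying the derivatives as data, rather than through [Derive], makes linear
   combinations and changes of variables of C2 functions term-level operations.
   [dxy] is the y-derivative of [dx], [dyx] the x-derivative of [dy]. *)
Record jet := Jet { val : R -> R -> R; dx : R -> R -> R; dy : R -> R -> R;
  dxx : R -> R -> R; dxy : R -> R -> R; dyx : R -> R -> R; dyy : R -> R -> R }.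

Definition has_partials (f fx fy : R -> R -> R) (x y : R) : Prop :=
  is_derive (fun t => f t y) x (fx x y) /\ is_derive (fun t => f x t) y (fy x y).

Record harmonic_at (j : jet) (x y : R) : Prop := {
  partials_val : has_partials (val j) (dx j) (dy j) x y;
  partials_dx : has_partials (dx j) (dxx j) (dxy j) x y;
  partials_dy : has_partials (dy j) (dyx j) (dyy j) x y;
  cont_val : continuity_2d_pt (val j) x y;
  cont_dx : continuity_2d_pt (dx j) x y;
  cont_dy : continuity_2d_pt (dy j) x y;
  cont_dxx : continuity_2d_pt (dxx j) x y;
  cont_dxy : continuity_2d_pt (dxy j) x y;
  cont_dyx : continuity_2d_pt (dyx j) x y;
  cont_dyy : continuity_2d_pt (dyy j) x y;
  laplace : dxx j x y + dyy j x y = 0 }.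

(** For a harmonic function the second derivative test alone is not contradictory. The term
    [e * u ^ 2] raises the Laplacian to [2 * e > 0], while at a maximum both pure second derivatives
    are nonpositive. *)
Lemma no_perturbed_interior_max (j : jet) (x y e : R) :
  0 < e -> locally_2d (harmonic_at j) x y ->
  locally_2d (fun u v => val j u v + e * u ^ 2 <= val j x y + e * x ^ 2) x y ->
  False.
Proof.
  intros He Hj Hmax.
  assert (H0 := locally_2d_singleton _ _ _ Hj).
  assert (Hx : dxx j x y + 2 * e <= 0).
  { apply (second_derivative_at_max (fun t => val j t y + e * t ^ 2)
             (fun t => dx j t y + 2 * e * t) x).
    - generalize (locally_2d_1d_const_y _ _ _ Hj); apply filter_imp; intros t Ht.
      apply (is_derive_plus (fun t => val j t y)); [apply Ht | ].
      auto_derive; [easy | ring].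
    - apply (is_derive_plus (fun t => dx j t y)); [apply H0 | ].
      auto_derive; [easy | ring].
    - exact (locally_2d_1d_const_y _ _ _ Hmax). }
  assert (Hy : dyy j x y <= 0).
  { apply (second_derivative_at_max (fun t => val j x t) (fun t => dy j x t) y).
    - generalize (locally_2d_1d_const_x _ _ _ Hj); apply filter_imp; intros t Ht.
      apply Ht.
    - apply H0.
    - generalize (locally_2d_1d_const_x _ _ _ Hmax); apply filter_imp; intros t Ht.
      lra. }
  pose proof (laplace _ _ _ H0); lra.
Qed.

(** The perturbation costs at most [e * (a ^ 2 + b ^ 2)], and [e] tends to 0. Asking for the sign
    only at maximizers lets the rectangle and the periodic strip share the argument. *)
Lemma nonpos_of_perturbed_max (f : R -> R -> R) (a b c d : R) :
  (forall x y, a <= x <= b -> c <= y <= d -> continuity_2d_pt f x y) ->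
  (forall e x0 y0, 0 < e -> a <= x0 <= b -> c <= y0 <= d ->
     (forall x y, a <= x <= b -> c <= y <= d ->
        f x y + e * x ^ 2 <= f x0 y0 + e * x0 ^ 2) -> f x0 y0 <= 0) ->
  forall x y, a <= x <= b -> c <= y <= d -> f x y <= 0.
Proof.
  intros Hf Hmax x y Hx Hy.
  assert (H : forall e, 0 < e -> f x y <= e * (a ^ 2 + b ^ 2)).
  { intros e He.
    destruct (extreme_value_2d (fun x y => f x y + e * x ^ 2) a b c d)
      as [x0 [y0 [Hx0 [Hy0 H]]]]; try lra.
    { intros u v Hu Hv; apply continuity_2d_pt_plus; [now apply Hf | ].
      apply (continuity_1d_2d_pt_comp (fun t => e * t ^ 2) (fun u v => u)).
      - apply derivable_continuous_pt; reg.
      - apply continuity_2d_pt_id1. }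
    pose proof (Hmax e x0 y0 He Hx0 Hy0 H).
    pose proof (H x y Hx Hy).
    assert (0 <= e * x ^ 2) by (apply Rmult_le_pos; nra).
    assert (x0 ^ 2 <= a ^ 2 + b ^ 2) by (destruct (Rle_dec 0 x0); nra).
    assert (e * x0 ^ 2 <= e * (a ^ 2 + b ^ 2)) by (apply Rmult_le_compat_l; lra).
    lra. }
  destruct (Rle_lt_dec (f x y) 0) as [Hl | Hl]; [exact Hl | exfalso].
  assert (HB : 0 < a ^ 2 + b ^ 2 + 1) by nra.
  (* This [e] brings the bound [e * (a ^ 2 + b ^ 2)] below [f x y / 2]. *)
  assert (HE : 0 < f x y / (2 * (a ^ 2 + b ^ 2 + 1)))
    by (apply Rdiv_lt_0_compat; lra).
  specialize (H _ HE).
  replace (f x y / (2 * (a ^ 2 + b ^ 2 + 1)) * (a ^ 2 + b ^ 2))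
    with (f x y / 2 - f x y / (2 * (a ^ 2 + b ^ 2 + 1))) in H by (field; lra).
  lra.
Qed.

Lemma open_rectangle (a b c d x y : R) :
  a < x < b -> c < y < d -> locally_2d (fun u v => a < u < b /\ c < v < d) x y.
Proof.
  intros Hx Hy.
  set (e := Rmin (Rmin (x - a) (b - x)) (Rmin (y - c) (d - y))).
  assert (He : 0 < e) by (unfold e; repeat apply Rmin_pos; lra).
  assert (H : e <= x - a /\ e <= b - x /\ e <= y - c /\ e <= d - y).
  { unfold e, Rmin; repeat destruct (Rle_dec _ _); lra. }
  exists (mkposreal e He); simpl; intros u v Hu Hv.
  apply Rabs_def2 in Hu; apply Rabs_def2 in Hv; lra.
Qed.

Lemma open_strip (a b x y : R) : a < x < b -> locally_2d (fun u _ => a < u < b) x y.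
Proof.
  intros Hx; destruct (open_rectangle a b (y - 1) (y + 1) x y Hx) as [d Hd]; [lra | ].
  exists d; intros u v Hu Hv; now apply (Hd u v).
Qed.

Lemma maximum_principle_rectangle (j : jet) (a b c d : R) :
  (forall x y, a <= x <= b -> c <= y <= d -> harmonic_at j x y) ->
  (forall x y, a <= x <= b -> c <= y <= d ->
     x = a \/ x = b \/ y = c \/ y = d -> val j x y <= 0) ->
  forall x y, a <= x <= b -> c <= y <= d -> val j x y <= 0.
Proof.
  intros Hj Hb; apply nonpos_of_perturbed_max.
  - intros x y Hx Hy; now apply cont_val, Hj.
  - intros e x0 y0 He Hx0 Hy0 Hmax.
    destruct (Req_dec x0 a); [apply Hb; tauto | ].
    destruct (Req_dec x0 b); [apply Hb; tauto | ].
    destruct (Req_dec y0 c); [apply Hb; tauto | ].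
    destruct (Req_dec y0 d); [apply Hb; tauto | ].
    exfalso; apply (no_perturbed_interior_max j x0 y0 e He).
    + apply locally_2d_impl
        with (2 := open_rectangle a b c d x0 y0 ltac:(lra) ltac:(lra)).
      apply locally_2d_forall; intros u v [Hu Hv]; apply Hj; lra.
    + apply locally_2d_impl
        with (2 := open_rectangle a b c d x0 y0 ltac:(lra) ltac:(lra)).
      apply locally_2d_forall; intros u v [Hu Hv]; apply Hmax; lra.
Qed.

(** One period of the strip supplies compactness, so only the two lines [x = a] and [x = b] count as
    boundary. The function [f] carries continuity up to these lines, the jet carries the equation
    inside. *)
Lemma maximum_principle_periodic (j : jet) (f : R -> R -> R) (a b T : R) :
  0 < T ->
  (forall x y, a <= x <= b -> continuity_2d_pt f x y) ->
  (forall x y, a <= x <= b -> f x (y + T) = f x y) ->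
  (forall x y, a < x < b -> f x y = val j x y /\ harmonic_at j x y) ->
  (forall x y, x = a \/ x = b -> f x y <= 0) ->
  forall x y, a <= x <= b -> f x y <= 0.
Proof.
  intros HT Hf Hper Hj Hb x y Hx.
  apply (nonpos_of_perturbed_max f a b y (y + T)); try lra.
  { intros u v Hu _; now apply Hf. }
  intros e x0 y0 He Hx0 Hy0 Hmax.
  destruct (Req_dec x0 a); [apply Hb; tauto | ].
  destruct (Req_dec x0 b); [apply Hb; tauto | ].
  exfalso; apply (no_perturbed_interior_max j x0 y0 e He).
  - apply locally_2d_impl with (2 := open_strip a b x0 y0 ltac:(lra)).
    apply locally_2d_forall; intros u v Hu; now apply Hj.
  - (* By periodicity a maximum on the sides [y, y + T] is still a local one. *)
    apply locally_2d_impl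
      with (2 := open_rectangle a b (y0 - T) (y0 + T) x0 y0 ltac:(lra) ltac:(lra)).
    apply locally_2d_forall; intros u v [Hu Hv].
    rewrite <- (proj1 (Hj u v Hu)), <- (proj1 (Hj x0 y0 ltac:(lra))).
    destruct (Rlt_le_dec v y) as [Hv1 | Hv1].
    + rewrite <- Hper by lra; apply Hmax; lra.
    + destruct (Rle_lt_dec v (y + T)) as [Hv2 | Hv2]; [apply Hmax; lra | ].
      replace v with (v - T + T) by ring; rewrite Hper by lra; apply Hmax; lra.
Qed.

(** * Interior derivative estimates *)

Definition jet_lin (a : R) (i : jet) (b : R) (j : jet) : jet :=
  let l f g := fun x y : R => a * f x y + b * g x y in
  Jet (l (val i) (val j)) (l (dx i) (dx j)) (l (dy i) (dy j))
    (l (dxx i) (dxx j)) (l (dxy i) (dxy j)) (l (dyx i) (dyx j)) (l (dyy i) (dyy j)).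

(* The jet of [f (s * x + h) (y + k)]: translations for [s = 1], reflections for
   [s = -1]. *)
Definition jet_aff (s h k : R) (j : jet) : jet :=
  let c m f := fun x y : R => m * f (s * x + h) (y + k) in
  Jet (c 1 (val j)) (c s (dx j)) (c 1 (dy j))
    (c (s * s) (dxx j)) (c s (dxy j)) (c s (dyx j)) (c 1 (dyy j)).

Definition jet_swap (j : jet) : jet :=
  let c f := fun x y : R => f y x in
  Jet (c (val j)) (c (dy j)) (c (dx j)) (c (dyy j)) (c (dyx j)) (c (dxy j)) (c (dxx j)).

(** A harmonic quadratic that vanishes at the origin, with slope [2 * m * c] in x there. *)
Definition jet_barrier (m c : R) : jet :=
  Jet (fun x y => m * (y ^ 2 - x ^ 2 + 2 * c * x)) (fun x y => m * (2 * c - 2 * x))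
    (fun x y => m * (2 * y)) (fun _ _ => - (2 * m)) (fun _ _ => 0) (fun _ _ => 0)
    (fun _ _ => 2 * m).

Lemma continuity_2d_pt_lin (a b : R) (f g : R -> R -> R) (x y : R) :
  continuity_2d_pt f x y -> continuity_2d_pt g x y ->
  continuity_2d_pt (fun u v => a * f u v + b * g u v) x y.
Proof.
  intros Hf Hg; apply continuity_2d_pt_plus; apply continuity_2d_pt_mult;
    try assumption; apply continuity_2d_pt_const.
Qed.

Lemma is_derive_lin (a b : R) (f g : R -> R) (x l m : R) :
  is_derive f x l -> is_derive g x m ->
  is_derive (fun t => a * f t + b * g t) x (a * l + b * m).
Proof.
  intros Hf Hg.
  apply (is_derive_plus (fun t => a * f t) (fun t => b * g t));
    now apply is_derive_scal.
Qed.

Lemma harmonic_lin (a b : R) (i j : jet) (x y : R) :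
  harmonic_at i x y -> harmonic_at j x y -> harmonic_at (jet_lin a i b j) x y.
Proof.
  intros Hi Hj; destruct Hi as [[] [] [] ? ? ? ? ? ? ? Ei];
    destruct Hj as [[] [] [] ? ? ? ? ? ? ? Ej].
  split; try split; simpl; try (apply is_derive_lin; assumption);
    try (apply continuity_2d_pt_lin; assumption).
  transitivity (a * (dxx i x y + dyy i x y) + b * (dxx j x y + dyy j x y)); [ring | ].
  rewrite Ei, Ej; ring.
Qed.

Lemma continuity_2d_pt_aff (m s h k : R) (f : R -> R -> R) (x y : R) :
  continuity_2d_pt f (s * x + h) (y + k) ->
  continuity_2d_pt (fun u v => m * f (s * u + h) (v + k)) x y.
Proof.
  intros Hf; apply continuity_2d_pt_mult; [apply continuity_2d_pt_const | ].
  apply (continuity_2d_pt_comp f); [exact Hf | | ].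
  - apply continuity_2d_pt_plus; [ | apply continuity_2d_pt_const].
    apply continuity_2d_pt_mult; [apply continuity_2d_pt_const | apply continuity_2d_pt_id1].
  - apply continuity_2d_pt_plus; [ | apply continuity_2d_pt_const].
    apply continuity_2d_pt_id2.
Qed.

Lemma is_derive_aff (m s h : R) (f : R -> R) (x l l' : R) :
  is_derive f (s * x + h) l -> l' = m * s * l ->
  is_derive (fun t => m * f (s * t + h)) x l'.
Proof.
  intros Hf ->.
  replace (m * s * l) with (m * (s * l)) by ring.
  apply is_derive_scal.
  apply (is_derive_comp f (fun t => s * t + h)); [exact Hf | ].
  auto_derive; [easy | ring].
Qed.

Lemma harmonic_aff (s h k : R) (j : jet) (x y : R) :
  s * s = 1 -> harmonic_at j (s * x + h) (y + k) -> harmonic_at (jet_aff s h k j) x y.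
Proof.
  intros Hs [[] [] [] ? ? ? ? ? ? ? E].
  assert (X : forall m l l' g, is_derive (fun t => g t (y + k)) (s * x + h) l ->
            l' = m * s * l -> is_derive (fun t => m * g (s * t + h) (y + k)) x l').
  { intros m l l' g Hg; now apply (is_derive_aff m s h (fun t => g t (y + k)) x l). }
  assert (Y : forall m l g, is_derive (fun t => g (s * x + h) t) (y + k) l ->
            is_derive (fun t => m * g (s * x + h) (t + k)) y (m * l)).
  { intros m l g Hg.
    apply (is_derive_ext (fun t => m * g (s * x + h) (1 * t + k)));
      [intros; now rewrite Rmult_1_l | ].
    apply (is_derive_aff m 1 k (g (s * x + h)) y l); [now rewrite Rmult_1_l | ring]. }
  split; try split; simpl; try (apply continuity_2d_pt_aff; assumption).
  - eapply X; [eassumption | ring].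
  - now apply Y.
  - eapply X; [eassumption | ring].
  - now apply Y.
  - eapply X; [eassumption | ring].
  - now apply Y.
  - rewrite Hs; lra.
Qed.

Lemma harmonic_swap (j : jet) (x y : R) :
  harmonic_at j y x -> harmonic_at (jet_swap j) x y.
Proof.
  intros [[] [] [] ? ? ? ? ? ? ? E].
  assert (C : forall f, continuity_2d_pt f y x -> continuity_2d_pt (fun u v => f v u) x y).
  { intros f Hf; apply (continuity_2d_pt_comp f (fun u v => v) (fun u v => u));
      [exact Hf | apply continuity_2d_pt_id2 | apply continuity_2d_pt_id1]. }
  split; try split; simpl; auto; lra.
Qed.

Lemma harmonic_barrier (m c x y : R) : harmonic_at (jet_barrier m c) x y.
Proof.
  assert (C : forall p q : R -> R,
             continuity p -> continuity q ->
             continuity_2d_pt (fun u v => m * (q v + p u)) x y).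
  { intros p q Hp Hq; apply continuity_2d_pt_mult; [apply continuity_2d_pt_const | ].
    apply continuity_2d_pt_plus.
    - apply (continuity_1d_2d_pt_comp q (fun u v => v)); [apply Hq | apply continuity_2d_pt_id2].
    - apply (continuity_1d_2d_pt_comp p (fun u v => u)); [apply Hp | apply continuity_2d_pt_id1]. }
  split; try split; simpl; try apply continuity_2d_pt_const;
    try (auto_derive; [easy | ring]); try ring.
  - apply continuity_2d_pt_ext with (fun u v => m * (v ^ 2 + (- u ^ 2 + 2 * c * u)));
      [intros; ring | ].
    apply (C (fun u => - u ^ 2 + 2 * c * u) (fun v => v ^ 2)); reg.
  - apply continuity_2d_pt_ext with (fun u v => m * (0 + (2 * c - 2 * u)));
      [intros; ring | ].
    apply (C (fun u => 2 * c - 2 * u) (fun v => 0)); reg.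
  - apply continuity_2d_pt_ext with (fun u v => m * (2 * v + 0));
      [intros; ring | ].
    apply (C (fun u => 0) (fun v => 2 * v)); reg.
Qed.

(** Right difference quotients suffice once the derivative exists; comparison on the half square
    [x >= 0] yields nothing else. *)
Lemma is_derive_upper_bound (f : R -> R) (x l K r : R) :
  0 < r -> is_derive f x l -> (forall h, 0 < h < r -> f (x + h) - f x <= K * h) ->
  l <= K.
Proof.
  intros Hr Hf Hb.
  apply is_derive_Reals in Hf.
  destruct (Rle_lt_dec l K) as [H | H]; [exact H | exfalso].
  destruct (Hf (l - K)) as [d Hd]; [lra | ].
  set (h := Rmin d r / 2).
  assert (Hh : 0 < h /\ h < d /\ h < r).
  { pose proof (cond_pos d); unfold h, Rmin; destruct (Rle_dec _ _); lra. }
  assert (Hq := Hd h ltac:(lra) ltac:(rewrite Rabs_pos_eq; lra)).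
  apply Rabs_def2 in Hq.
  assert (K * h < (f (x + h) - f x) / h * h) by (apply Rmult_lt_compat_r; lra).
  replace ((f (x + h) - f x) / h * h) with (f (x + h) - f x) in H0 by (field; lra).
  specialize (Hb h ltac:(lra)); lra.
Qed.

Lemma is_derive_Rabs_bound (f : R -> R) (x l K r : R) :
  0 < r -> is_derive f x l ->
  (forall h, 0 < h < r -> Rabs (f (x + h) - f x) <= K * h) -> Rabs l <= K.
Proof.
  intros Hr Hf Hb; apply Rabs_le; split.
  - apply Ropp_le_cancel; rewrite Ropp_involutive.
    apply (is_derive_upper_bound (fun t => - f t) x (- l) K r Hr).
    + now apply (is_derive_opp f).
    + intros h Hh; specialize (Hb h Hh); apply Rabs_le_between in Hb; lra.
  - apply (is_derive_upper_bound f x l K r Hr Hf).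
    intros h Hh; specialize (Hb h Hh); apply Rabs_le_between in Hb; lra.
Qed.

Definition bounded_on_square (j : jet) (p q r M : R) : Prop :=
  forall x y, Rabs (x - p) <= r -> Rabs (y - q) <= r ->
    harmonic_at j x y /\ Rabs (val j x y) <= M.

(* The odd part of [j] in x is harmonic and vanishes on x = 0, and the barrier
   [M / r^2 (y^2 - x^2 + 2 r x)] dominates it on the boundary of the half square,
   hence inside. *)
Lemma gradient_upper_bound_at_origin (j : jet) (r M : R) :
  0 < r -> bounded_on_square j 0 0 r M -> dx j 0 0 <= 2 * M / r.
Proof.
  intros Hr Hj.
  assert (Hv : forall x y, Rabs x <= r -> Rabs y <= r ->
             harmonic_at j x y /\ - M <= val j x y <= M).
  { intros x y Hx Hy; destruct (Hj x y) as [H1 H2]; rewrite ?Rminus_0_r; auto.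
    apply Rabs_le_between in H2; split; auto; lra. }
  assert (HM : 0 <= M).
  { destruct (Hv 0 0) as [_ H]; rewrite ?Rabs_R0; lra. }
  assert (E : exists m, 0 <= m /\ M = m * (r * r) /\ 2 * M / r = m * (2 * r)).
  { exists (M / r ^ 2); split; [apply Rdiv_le_0_compat; nra | split; field; lra]. }
  destruct E as [m [HB [HM' Hm]]]; rewrite Hm; clear Hm.
  set (odd := jet_lin (1 / 2) j (- (1 / 2)) (jet_aff (-1) 0 0 j)).
  set (k := jet_lin 1 odd (-1) (jet_barrier m r)).
  assert (Hk : forall x y, 0 <= x <= r -> - r <= y <= r -> val k x y <= 0).
  { apply maximum_principle_rectangle.
    - intros x y Hx Hy.
      apply harmonic_lin; [apply harmonic_lin | apply harmonic_barrier].
      + apply Hv; apply Rabs_le; lra.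
      + apply harmonic_aff; [ring | apply Hv; apply Rabs_le; lra].
    - intros x y Hx Hy Hxy.
      destruct (Hv x y) as [_ H1]; [apply Rabs_le; lra .. | ].
      destruct (Hv (-1 * x + 0) (y + 0)) as [_ H2]; [apply Rabs_le; lra .. | ].
      unfold k, odd; simpl.
      destruct Hxy as [-> | Hxy].
      + replace (-1 * 0 + 0) with 0 by ring; rewrite Rplus_0_r.
        assert (0 <= m * (y * y)) by (apply Rmult_le_pos; nra).
        lra.
      (* The excess over [r * r] is [y ^ 2] on the side [x = r] and [x * (2 * r - x)] on the sides
         [y = - r] and [y = r]. The barrier is thus at least [m * (r * r) = M], which bounds the odd
         part. *)
      + assert (HQ : r * r <= y * (y * 1) - x * (x * 1) + 2 * r * x).
        { destruct Hxy as [-> | [-> | ->]]; nra. }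
        apply Rmult_le_compat_l with (1 := HB) in HQ.
        simpl in *; lra. }
  apply (is_derive_upper_bound (fun x => val odd x 0) 0 _ _ r Hr).
  - apply (is_derive_ext (fun t => 1 / 2 * val j t 0 + - (1 / 2) * (1 * val j (-1 * t + 0) 0)));
      [intros; simpl; now rewrite (Rplus_0_r 0) | ].
    replace (dx j 0 0) with (1 / 2 * dx j 0 0 + - (1 / 2) * (- dx j 0 0)) by field.
    destruct (Hv 0 0) as [[[D _] _ _ _ _ _ _ _ _ _ _] _]; [rewrite Rabs_R0; lra .. | ].
    apply is_derive_lin; [exact D | ].
    apply (is_derive_aff 1 (-1) 0 (fun t => val j t 0) 0 (dx j 0 0)); [ | ring].
    replace (-1 * 0 + 0) with 0 by ring; exact D.
  - intros h Hh; rewrite Rplus_0_l.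
    specialize (Hk h 0 ltac:(lra) ltac:(lra)).
    assert (E : val odd 0 0 = 0).
    { unfold odd; simpl; replace (-1 * 0 + 0) with 0 by ring; rewrite Rplus_0_r; ring. }
    rewrite E; unfold k in Hk; simpl val in Hk; simpl val at 1.
    (* At [(h, 0)] the barrier is [m * (2 * r * h - h ^ 2)]; dropping the square leaves the linear
       bound with slope [m * (2 * r) = 2 * M / r]. *)
    assert (0 <= m * h ^ 2) by (apply Rmult_le_pos; nra).
    unfold odd; simpl val; lra.
Qed.

(** Sign, centre and direction reduce to the upper bound for [dx] at the origin by linearity,
    translation and exchange of the variables. *)
Lemma gradient_bound (j : jet) (p q r M : R) :
  0 < r -> bounded_on_square j p q r M ->
  Rabs (dx j p q) <= 2 * M / r /\ Rabs (dy j p q) <= 2 * M / r.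
Proof.
  assert (X : forall j p q, 0 < r -> bounded_on_square j p q r M ->
                            Rabs (dx j p q) <= 2 * M / r).
  { clear; intros j p q Hr Hj.
    assert (U : forall s, s * s = 1 -> s * dx j p q <= 2 * M / r).
    { intros s Hs.
      (* [jet_lin s j 0 j] is [s] times [j]; [s = -1] turns the upper bound into the lower one. *)
      set (k := jet_aff 1 p q (jet_lin s j 0 j)).
      replace (s * dx j p q) with (dx k 0 0)
        by (unfold k; simpl; replace (1 * 0 + p) with p by ring; rewrite Rplus_0_l; ring).
      apply gradient_upper_bound_at_origin; [exact Hr | ].
      intros x y; rewrite !Rminus_0_r; intros Hx Hy.
      destruct (Hj (1 * x + p) (y + q)) as [H1 H2].
      { now replace (1 * x + p - p) with x by ring. }
      { now replace (y + q - q) with y by ring. }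
      split; [apply harmonic_aff; [ring | now apply harmonic_lin] | ].
      simpl; rewrite Rmult_0_l, Rplus_0_r, !Rabs_mult, Rabs_R1.
      assert (Rabs s = 1).
      { rewrite <- (Rabs_pos_eq 1) by lra.
        apply Rsqr_eq_abs_0; unfold Rsqr; lra. }
      rewrite H; lra. }
    apply Rabs_le; pose proof (U 1 ltac:(ring)); pose proof (U (-1) ltac:(ring)); lra. }
  intros Hr Hj; split; [now apply X | ].
  apply (X (jet_swap j) q p Hr).
  intros x y Hx Hy; destruct (Hj y x Hy Hx); split; [now apply harmonic_swap | easy].
Qed.

Lemma Rabs_triang_dist (x y z r s : R) :
  Rabs (x - y) <= r -> Rabs (y - z) <= s -> Rabs (x - z) <= r + s.
Proof.
  intros H1 H2; replace (x - z) with ((x - y) + (y - z)) by ring.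
  eapply Rle_trans; [apply Rabs_triang | lra].
Qed.

(* The gradient bound applied to the difference quotient of [j] in x controls the
   x-derivatives of both [dx j] and [dy j]. *)
Lemma hessian_bound (j : jet) (p q r M : R) :
  0 < r -> bounded_on_square j p q r M ->
  (Rabs (dxx j p q) <= 32 * M / r ^ 2 /\ Rabs (dyx j p q) <= 32 * M / r ^ 2) /\
  (Rabs (dxy j p q) <= 32 * M / r ^ 2 /\ Rabs (dyy j p q) <= 32 * M / r ^ 2).
Proof.
  assert (X : forall j p q, 0 < r -> bounded_on_square j p q r M ->
    Rabs (dxx j p q) <= 32 * M / r ^ 2 /\ Rabs (dyx j p q) <= 32 * M / r ^ 2).
  { clear; intros j p q Hr Hj.
    assert (G : forall x y, Rabs (x - p) <= r / 2 -> Rabs (y - q) <= r / 2 ->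
              Rabs (dx j x y) <= 4 * M / r).
    { intros x y Hx Hy.
      replace (4 * M / r) with (2 * M / (r / 2)) by (field; lra).
      apply (gradient_bound j x y (r / 2) M); [lra | ].
      intros u v Hu Hv; apply Hj.
      - replace r with (r / 2 + r / 2) by field; now apply Rabs_triang_dist with x.
      - replace r with (r / 2 + r / 2) by field; now apply Rabs_triang_dist with y. }
    assert (Q : forall h, 0 < h < r / 4 ->
              let g := jet_lin (/ h) (jet_aff 1 h 0 j) (- / h) j in
              Rabs (dx g p q) <= 32 * M / r ^ 2 /\ Rabs (dy g p q) <= 32 * M / r ^ 2).
    { intros h Hh g.
      (* The quotient is a value of [dx j] at an intermediate point, hence bounded by [4 * M / r].
         On the square of half side [r / 4] a step [h < r / 4] keeps that point where [G] applies,
         and the gradient bound on this square gives the factor 32. *)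
      replace (32 * M / r ^ 2) with (2 * (4 * M / r) / (r / 4)) by (field; lra).
      apply gradient_bound; [lra | ].
      intros x y Hx Hy.
      assert (Hxh : forall t, x <= t <= x + h -> Rabs (t - p) <= r / 2).
      { intros t Ht; replace (r / 2) with (r / 4 + r / 4) by field.
        apply Rabs_triang_dist with x; [apply Rabs_le; lra | exact Hx]. }
      split.
      - apply harmonic_lin; [apply harmonic_aff; [ring | ] | ]; apply Hj; try lra.
        + replace (1 * x + h) with (x + h) by ring.
          apply Rle_trans with (r / 2); [apply Hxh; lra | lra].
        + rewrite Rplus_0_r; lra.
      - unfold g; simpl; rewrite Rplus_0_r, !Rmult_1_l.
        destruct (MVT_gen (fun t => val j t y) x (x + h) (fun t => dx j t y))
          as [c [Hc E]].
        { intros t; rewrite Rmin_left, Rmax_right by lra; intros Ht.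
          apply Hj; [ | lra].
          apply Rle_trans with (r / 2); [apply Hxh; lra | lra]. }
        { intros t; rewrite Rmin_left, Rmax_right by lra; intros Ht.
          apply derivable_continuous_pt; exists (dx j t y); apply is_derive_Reals.
          apply Hj; [ | lra].
          apply Rle_trans with (r / 2); [apply Hxh; lra | lra]. }
        rewrite Rmin_left, Rmax_right in Hc by lra.
        replace (/ h * val j (x + h) y + - / h * val j x y) with (dx j c y).
        + apply G; [now apply Hxh | lra].
        + transitivity ((val j (x + h) y - val j x y) / h); [ | field; lra].
          rewrite E; field; lra. }
    destruct (Hj p q) as [Hpq _]; [rewrite Rminus_diag, Rabs_R0; lra .. | ].
    split.
    - apply (is_derive_Rabs_bound (fun t => dx j t q) p _ _ (r / 4)); [lra | apply Hpq | ].
      intros h Hh; destruct (Q h Hh) as [H _]; revert H.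
      simpl; rewrite Rplus_0_r, !Rmult_1_l; intros H.
      replace (dx j (p + h) q - dx j p q)
        with ((/ h * dx j (p + h) q + - / h * dx j p q) * h) by (field; lra).
      rewrite Rabs_mult, (Rabs_pos_eq h) by lra.
      apply Rmult_le_compat_r; [lra | exact H].
    - apply (is_derive_Rabs_bound (fun t => dy j t q) p _ _ (r / 4)); [lra | apply Hpq | ].
      intros h Hh; destruct (Q h Hh) as [_ H]; revert H.
      simpl; rewrite Rplus_0_r, !Rmult_1_l; intros H.
      replace (dy j (p + h) q - dy j p q)
        with ((/ h * dy j (p + h) q + - / h * dy j p q) * h) by (field; lra).
      rewrite Rabs_mult, (Rabs_pos_eq h) by lra.
      apply Rmult_le_compat_r; [lra | exact H]. }
  intros Hr Hj; split; [now apply X | ].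
  apply and_comm; apply (X (jet_swap j) q p Hr).
  intros x y Hx Hy; destruct (Hj y x Hy Hx); split; [now apply harmonic_swap | easy].
Qed.

(** * Limits of harmonic functions *)

(** A Cauchy condition rather than convergence, because the limits of the derivatives are not known
    in advance. *)
Definition cauchy_on_square (F : nat -> R -> R -> R) (p q r : R) : Prop :=
  forall eps, 0 < eps -> exists N, forall n m, (N <= n)%nat -> (N <= m)%nat ->
    forall x y, Rabs (x - p) <= r -> Rabs (y - q) <= r -> Rabs (F n x y - F m x y) <= eps.

Definition lim_fun (F : nat -> R -> R -> R) (x y : R) : R :=
  Lim_seq (fun n => F n x y).

Lemma lim_fun_correct (F : nat -> R -> R -> R) (p q r x y : R) :
  cauchy_on_square F p q r -> Rabs (x - p) <= r -> Rabs (y - q) <= r ->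
  is_lim_seq (fun n => F n x y) (lim_fun F x y).
Proof.
  intros HF Hx Hy; apply Lim_seq_correct', ex_lim_seq_cauchy_corr; intros eps.
  destruct (HF (eps / 2)) as [N HN]; [apply is_pos_div_2 | ].
  exists N; intros n m Hn Hm.
  apply Rle_lt_trans with (eps / 2); [now apply HN | ].
  pose proof (cond_pos eps); lra.
Qed.

Lemma lim_fun_uniform (F : nat -> R -> R -> R) (p q r eps : R) :
  cauchy_on_square F p q r -> 0 < eps ->
  exists N, forall n, (N <= n)%nat ->
    forall x y, Rabs (x - p) <= r -> Rabs (y - q) <= r ->
      Rabs (F n x y - lim_fun F x y) <= eps.
Proof.
  intros HF Heps; destruct (HF (eps / 2)) as [N HN]; [lra | ].
  exists N; intros n Hn x y Hx Hy.
  assert (He : 0 < eps / 2) by lra.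
  assert (L := lim_fun_correct _ _ _ _ _ _ HF Hx Hy).
  apply is_lim_seq_spec in L.
  destruct (L (mkposreal _ He)) as [N' HN']; simpl in HN'.
  specialize (HN n (max N N') Hn (Nat.le_max_l _ _) x y Hx Hy).
  specialize (HN' (max N N') (Nat.le_max_r _ _)).
  replace (F n x y - lim_fun F x y)
    with ((F n x y - F (max N N') x y) + (F (max N N') x y - lim_fun F x y)) by ring.
  eapply Rle_trans; [apply Rabs_triang | lra].
Qed.

(** The threshold [N0], here and below, is needed because a difference quotient is harmonic near a
    given point only when its step is small. *)
Lemma continuity_lim_fun (F : nat -> R -> R -> R) (p q r : R) (N0 : nat) :
  0 < r -> cauchy_on_square F p q r ->
  (forall n, (N0 <= n)%nat -> continuity_2d_pt (F n) p q) ->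
  continuity_2d_pt (lim_fun F) p q.
Proof.
  intros Hr HF HC eps.
  assert (He : 0 < eps / 4) by (pose proof (cond_pos eps); lra).
  destruct (lim_fun_uniform F p q r (eps / 4) HF He) as [N HN].
  set (n := max N N0).
  destruct (HC n (Nat.le_max_r _ _) (mkposreal _ He)) as [d Hd]; simpl in Hd.
  assert (Hm : 0 < Rmin d r) by (apply Rmin_pos; [apply cond_pos | exact Hr]).
  exists (mkposreal _ Hm); simpl; intros u v Hu Hv.
  assert (Hu' := Rlt_le_trans _ _ _ Hu (Rmin_l _ _)).
  assert (Hu'' := Rlt_le_trans _ _ _ Hu (Rmin_r _ _)).
  assert (Hv' := Rlt_le_trans _ _ _ Hv (Rmin_l _ _)).
  assert (Hv'' := Rlt_le_trans _ _ _ Hv (Rmin_r _ _)).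
  assert (H1 := HN n (Nat.le_max_l _ _) u v ltac:(lra) ltac:(lra)).
  assert (H2 := HN n (Nat.le_max_l _ _) p q
                  ltac:(rewrite Rminus_diag, Rabs_R0; lra)
                  ltac:(rewrite Rminus_diag, Rabs_R0; lra)).
  assert (H3 := Hd u v Hu' Hv').
  apply Rabs_le_between in H1; apply Rabs_le_between in H2; apply Rabs_def2 in H3.
  apply Rabs_def1; lra.
Qed.

(** The mean value theorem for [fn m - fn N] bounds the gap between the increments of [fn m] and
    [fn N] by a small multiple of [Rabs h]. Letting [m] tend to infinity replaces [fn m] by [f], and
    the derivative of the single function [fn N] finishes. *)
Lemma is_derive_lim (fn fn' : nat -> R -> R) (f : R -> R) (p g r : R) (N0 : nat) :
  0 < r ->
  (forall eps, 0 < eps -> exists N, forall n m, (N <= n)%nat -> (N <= m)%nat ->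
     forall x, Rabs (x - p) <= r -> Rabs (fn' n x - fn' m x) <= eps) ->
  (forall x, Rabs (x - p) <= r -> is_lim_seq (fun n => fn n x) (f x)) ->
  is_lim_seq (fun n => fn' n p) g ->
  (forall n x, (N0 <= n)%nat -> Rabs (x - p) <= r -> is_derive (fn n) x (fn' n x)) ->
  is_derive f p g.
Proof.
  intros Hr HA HB HC HD; apply is_derive_Reals; intros eps Heps.
  assert (He : 0 < eps / 4) by lra.
  destruct (HA (eps / 4) He) as [N1 HN1].
  apply is_lim_seq_spec in HC; destruct (HC (mkposreal _ He)) as [N2 HN2]; simpl in HN2.
  set (N := max N0 (max N1 N2)).
  assert (HN : (N0 <= N /\ N1 <= N /\ N2 <= N)%nat) by (unfold N; lia).
  assert (Hp : Rabs (p - p) <= r) by (rewrite Rminus_diag, Rabs_R0; lra).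
  assert (DN := HD N p (proj1 HN) Hp).
  apply is_derive_Reals in DN; destruct (DN (eps / 4) He) as [d Hd].
  assert (Hm : 0 < Rmin d r) by (apply Rmin_pos; [apply cond_pos | exact Hr]).
  exists (mkposreal _ Hm); simpl; intros h Hh0 Hh.
  assert (Hh1 := Rlt_le_trans _ _ _ Hh (Rmin_l _ _)).
  assert (Hh2 := Rlt_le_trans _ _ _ Hh (Rmin_r _ _)).
  assert (Hseg : forall c, Rmin p (p + h) <= c <= Rmax p (p + h) -> Rabs (c - p) <= r).
  { intros c; unfold Rmin, Rmax; destruct (Rle_dec _ _); intros Hc;
      apply Rabs_def2 in Hh2; apply Rabs_le; lra. }
  assert (Hph : Rabs (p + h - p) <= r) by (replace (p + h - p) with h by ring; lra).
  assert (K : Rabs ((f (p + h) - f p) - (fn N (p + h) - fn N p)) <= eps / 4 * Rabs h).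
  { apply (is_lim_seq_le_loc
             (fun m => Rabs ((fn m (p + h) - fn m p) - (fn N (p + h) - fn N p)))
             (fun _ => eps / 4 * Rabs h)
             (Finite (Rabs ((f (p + h) - f p) - (fn N (p + h) - fn N p))))
             (Finite (eps / 4 * Rabs h))).
    - exists N; intros m Hm'.
      destruct (MVT_gen (fun t => fn m t - fn N t) p (p + h) (fun t => fn' m t - fn' N t))
        as [c [Hc E]].
      + intros t Ht.
        apply (is_derive_minus (fn m) (fn N)); apply HD; try lia; apply Hseg; lra.
      + intros t Ht; apply derivable_continuous_pt; exists (fn' m t - fn' N t).
        apply is_derive_Reals.
        apply (is_derive_minus (fn m) (fn N)); apply HD; try lia; apply Hseg; lra.
      + replace (fn m (p + h) - fn m p - (fn N (p + h) - fn N p))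
          with ((fn' m c - fn' N c) * h) by lra.
        rewrite Rabs_mult; apply Rmult_le_compat_r; [apply Rabs_pos | ].
        apply HN1; [lia | lia | now apply Hseg].
    - apply (is_lim_seq_abs _ (Finite _)).
      apply is_lim_seq_minus'; [ | apply is_lim_seq_const].
      apply is_lim_seq_minus'; now apply HB.
    - apply is_lim_seq_const. }
  specialize (Hd h Hh0 Hh1); specialize (HN2 N (proj2 (proj2 HN))).
  replace ((f (p + h) - f p) / h - g)
    with (((f (p + h) - f p) - (fn N (p + h) - fn N p)) / h
          + (((fn N (p + h) - fn N p) / h - fn' N p) + (fn' N p - g))) by (now field).
  assert (K' : Rabs (((f (p + h) - f p) - (fn N (p + h) - fn N p)) / h) <= eps / 4).
  { unfold Rdiv at 1; rewrite Rabs_mult, Rabs_inv.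
    apply Rmult_le_reg_r with (Rabs h); [now apply Rabs_pos_lt | ].
    rewrite Rmult_assoc, Rinv_l, Rmult_1_r; [exact K | now apply Rabs_no_R0]. }
  eapply Rle_lt_trans; [apply Rabs_triang | ].
  assert (K2 := Rabs_triang ((fn N (p + h) - fn N p) / h - fn' N p) (fn' N p - g)).
  lra.
Qed.

Lemma has_partials_lim (F Fx Fy : nat -> R -> R -> R) (p q r : R) (N0 : nat) :
  0 < r ->
  cauchy_on_square F p q r -> cauchy_on_square Fx p q r -> cauchy_on_square Fy p q r ->
  (forall n x y, (N0 <= n)%nat -> Rabs (x - p) <= r -> Rabs (y - q) <= r ->
     has_partials (F n) (Fx n) (Fy n) x y) ->
  has_partials (lim_fun F) (lim_fun Fx) (lim_fun Fy) p q.
Proof.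
  intros Hr HF HFx HFy HD.
  assert (H0 : forall x, Rabs (x - x) <= r) by (intros; rewrite Rminus_diag, Rabs_R0; lra).
  split.
  - apply (is_derive_lim (fun n t => F n t q) (fun n t => Fx n t q) _ p _ r N0 Hr).
    + intros eps He; destruct (HFx eps He) as [N HN]; exists N; intros; now apply HN.
    + intros x Hx; now apply lim_fun_correct with p q r.
    + now apply lim_fun_correct with p q r.
    + intros n x Hn Hx; now apply HD.
  - apply (is_derive_lim (fun n t => F n p t) (fun n t => Fy n p t) _ q _ r N0 Hr).
    + intros eps He; destruct (HFy eps He) as [N HN]; exists N; intros; now apply HN.
    + intros y Hy; now apply lim_fun_correct with p q r.
    + now apply lim_fun_correct with p q r.
    + intros n y Hn Hy; now apply HD.
Qed.

Definition jet_lim (F : nat -> jet) : jet :=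
  let l D := lim_fun (fun n => D (F n)) in
  Jet (l val) (l dx) (l dy) (l dxx) (l dxy) (l dyx) (l dyy).

(** The interior estimates for [F n - F m] turn the Cauchy property of the values into that of all
    six derivatives on the half square, after which limits and derivatives may be exchanged. *)
Lemma harmonic_lim (F : nat -> jet) (p q r : R) (N0 : nat) :
  0 < r -> cauchy_on_square (fun n => val (F n)) p q r ->
  (forall n x y, (N0 <= n)%nat -> Rabs (x - p) <= r -> Rabs (y - q) <= r ->
     harmonic_at (F n) x y) ->
  harmonic_at (jet_lim F) p q.
Proof.
  intros Hr HF HH.
  assert (X : forall (D : jet -> R -> R -> R) (C : R), 0 < C ->
    (forall i j x y, D (jet_lin 1 i (-1) j) x y = D i x y - D j x y) ->
    (forall j x y M, bounded_on_square j x y (r / 2) M -> Rabs (D j x y) <= C * M) ->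
    cauchy_on_square (fun n => D (F n)) p q (r / 2)).
  { intros D C HC Hlin Hbd eps He.
    destruct (HF (eps / C)) as [N HN]; [now apply Rdiv_lt_0_compat | ].
    exists (max N N0); intros n m Hn Hm x y Hx Hy.
    rewrite <- Hlin.
    replace eps with (C * (eps / C)) by (field; lra).
    apply Hbd; intros u v Hu Hv.
    assert (Hu' : Rabs (u - p) <= r)
      by (replace r with (r / 2 + r / 2) by field; now apply Rabs_triang_dist with x).
    assert (Hv' : Rabs (v - q) <= r)
      by (replace r with (r / 2 + r / 2) by field; now apply Rabs_triang_dist with y).
    split.
    - apply harmonic_lin; apply HH; trivial; lia.
    - simpl; replace (1 * val (F n) u v + -1 * val (F m) u v)
        with (val (F n) u v - val (F m) u v) by ring.
      apply HN; trivial; lia. }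
  (* These are the gradient and Hessian constants for half side [r / 2]: a square of that size about
     any point of the half square stays in the full one. *)
  assert (P1 : 0 < 4 / r) by (apply Rdiv_lt_0_compat; lra).
  assert (P2 : 0 < 128 / r ^ 2) by (apply Rdiv_lt_0_compat; nra).
  assert (E1 : forall M, 4 / r * M = 2 * M / (r / 2)) by (intros; field; lra).
  assert (E2 : forall M, 128 / r ^ 2 * M = 32 * M / (r / 2) ^ 2) by (intros; field; lra).
  assert (r2 : 0 < r / 2) by lra.
  assert (C0 : cauchy_on_square (fun n => val (F n)) p q (r / 2)).
  { intros eps He; destruct (HF eps He) as [N HN]; exists N; intros.
    apply HN; trivial; lra. }
  assert (C1 : cauchy_on_square (fun n => dx (F n)) p q (r / 2)).
  { apply (X dx _ P1); [intros; simpl; ring | intros; rewrite E1].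
    now apply gradient_bound. }
  assert (C2 : cauchy_on_square (fun n => dy (F n)) p q (r / 2)).
  { apply (X dy _ P1); [intros; simpl; ring | intros; rewrite E1].
    now apply gradient_bound. }
  assert (C3 : cauchy_on_square (fun n => dxx (F n)) p q (r / 2)).
  { apply (X dxx _ P2); [intros; simpl; ring | intros; rewrite E2].
    now apply hessian_bound. }
  assert (C4 : cauchy_on_square (fun n => dxy (F n)) p q (r / 2)).
  { apply (X dxy _ P2); [intros; simpl; ring | intros; rewrite E2].
    now apply hessian_bound. }
  assert (C5 : cauchy_on_square (fun n => dyx (F n)) p q (r / 2)).
  { apply (X dyx _ P2); [intros; simpl; ring | intros; rewrite E2].
    now apply hessian_bound. }
  assert (C6 : cauchy_on_square (fun n => dyy (F n)) p q (r / 2)).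
  { apply (X dyy _ P2); [intros; simpl; ring | intros; rewrite E2].
    now apply hessian_bound. }
  assert (H0 : forall x, Rabs (x - x) <= r / 2)
    by (intros; rewrite Rminus_diag, Rabs_R0; lra).
  assert (HH2 : forall n x y, (N0 <= n)%nat -> Rabs (x - p) <= r / 2 ->
            Rabs (y - q) <= r / 2 -> harmonic_at (F n) x y)
    by (intros; apply HH; trivial; lra).
  split.
  1-3: apply has_partials_lim with (r / 2) N0; trivial; intros; now apply HH2.
  1-7: apply continuity_lim_fun with (r / 2) N0; trivial; intros; now apply HH2.
  assert (L := is_lim_seq_plus' _ _ _ _
                 (lim_fun_correct _ _ _ _ _ _ C3 (H0 p) (H0 q))
                 (lim_fun_correct _ _ _ _ _ _ C6 (H0 p) (H0 q))).
  assert (L0 : is_lim_seq (fun n => dxx (F n) p q + dyy (F n) p q) 0).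
  { apply is_lim_seq_ext_loc with (fun _ => 0); [ | apply is_lim_seq_const].
    exists N0; intros n Hn; symmetry; now apply laplace, HH2. }
  apply is_lim_seq_unique in L; apply is_lim_seq_unique in L0.
  rewrite L0 in L; injection L as L; symmetry; exact L.
Qed.

(* The difference quotients of [j] in x are harmonic and converge locally uniformly
   to [dx j]. *)
Lemma harmonic_dx (j : jet) (a b : R) :
  (forall x y, a < x < b -> harmonic_at j x y) ->
  exists k, forall x y, a < x < b -> harmonic_at k x y /\ val k x y = dx j x y.
Proof.
  intros Hj.
  set (h := fun n => / (INR n + 1)).
  set (F := fun n => jet_lin (/ h n) (jet_aff 1 (h n) 0 j) (- / h n) j).
  assert (Hpos : forall n, 0 < h n)
    by (intros; apply Rinv_0_lt_compat; pose proof (pos_INR n); lra).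
  assert (Hh : forall e, 0 < e -> exists N, forall n, (N <= n)%nat -> h n < e).
  { intros e He; destruct (archimed_cor1 e He) as [N [HN HN0]].
    exists N; intros n Hn; apply Rlt_trans with (2 := HN).
    apply Rinv_lt_contravar.
    - apply lt_INR in HN0; simpl in HN0; pose proof (pos_INR n).
      apply Rmult_lt_0_compat; lra.
    - apply le_INR in Hn; lra. }
  (* The limit is pointwise, so one jet serves all points; only the size of the square depends on
     [p]. *)
  exists (jet_lim F); intros p q Hp.
  (* A third leaves room for both the square of half side [r] and a step shorter than [r]. *)
  set (r := Rmin (p - a) (b - p) / 3).
  assert (Hr : 0 < r) by (unfold r, Rmin; destruct (Rle_dec _ _); lra).
  assert (Hin : forall x, p - 2 * r <= x <= p + 2 * r -> a < x < b)
    by (intros x; unfold r, Rmin; destruct (Rle_dec _ _); lra).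
  assert (Hclose : forall eps, 0 < eps -> exists N, forall n, (N <= n)%nat ->
            forall x y, Rabs (x - p) <= r -> Rabs (y - q) <= r ->
            Rabs (val (F n) x y - dx j x y) <= eps).
  { intros eps He.
    (* The quotient at [(x, y)] equals [dx j c y] with [c] within [h n] of [x], so uniform
       continuity of [dx j] gives uniform convergence. *)
    destruct (uniform_continuity_2d (dx j) (p - 2 * r) (p + 2 * r) (q - r) (q + r))
      with (mkposreal eps He) as [d Hd]; [intros; now apply cont_dx, Hj, Hin | ].
    simpl in Hd.
    destruct (Hh (Rmin d r)) as [N HN];
      [apply Rmin_pos; [apply cond_pos | exact Hr] | ].
    exists N; intros n Hn x y Hx Hy.
    assert (H1 := Rlt_le_trans _ _ _ (HN n Hn) (Rmin_l _ _)).
    assert (H2 := Rlt_le_trans _ _ _ (HN n Hn) (Rmin_r _ _)).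
    assert (H3 := Hpos n).
    apply Rabs_le_between in Hx; apply Rabs_le_between in Hy.
    unfold F; simpl; rewrite Rplus_0_r, !Rmult_1_l.
    destruct (MVT_gen (fun t => val j t y) x (x + h n) (fun t => dx j t y)) as [c [Hc E]].
    { intros t; rewrite Rmin_left, Rmax_right by lra; intros Ht.
      apply Hj, Hin; lra. }
    { intros t; rewrite Rmin_left, Rmax_right by lra; intros Ht.
      apply derivable_continuous_pt; exists (dx j t y); apply is_derive_Reals.
      apply Hj, Hin; lra. }
    rewrite Rmin_left, Rmax_right in Hc by lra.
    replace (/ h n * val j (x + h n) y + - / h n * val j x y) with (dx j c y).
    - apply Rlt_le, Hd; try lra; [apply Rabs_def1; lra | ].
      rewrite Rminus_diag, Rabs_R0; apply cond_pos.
    - transitivity ((val j (x + h n) y - val j x y) / h n); [ | field; lra].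
      rewrite E; field; lra. }
  split.
  - destruct (Hh r Hr) as [N0 HN0].
    apply harmonic_lim with r N0; [exact Hr | | ].
    + intros eps He; destruct (Hclose (eps / 2)) as [N HN]; [lra | ].
      exists N; intros n m Hn Hm x y Hx Hy.
      assert (H1 := HN n Hn x y Hx Hy); assert (H2 := HN m Hm x y Hx Hy).
      apply Rabs_le_between in H1; apply Rabs_le_between in H2; apply Rabs_le; lra.
    + intros n x y Hn Hx Hy.
      assert (H1 := HN0 n Hn); assert (H2 := Hpos n).
      apply Rabs_le_between in Hx.
      apply harmonic_lin; [apply harmonic_aff; [ring | ] | ]; apply Hj, Hin; lra.
  - simpl; unfold lim_fun.
    rewrite (is_lim_seq_unique _ (dx j p q)); [reflexivity | ].
    apply is_lim_seq_spec; intros eps.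
    destruct (Hclose (eps / 2)) as [N HN]; [apply is_pos_div_2 | ].
    exists N; intros n Hn; apply Rle_lt_trans with (eps / 2).
    + apply HN; trivial; rewrite Rminus_diag, Rabs_R0; lra.
    + pose proof (cond_pos eps); lra.
Qed.

(** * The polar problems *)

Lemma continuity_pt_clamp (a b x : R) : continuity_pt (clamp a b) x.
Proof.
  apply continuity_pt_locally; intros eps; exists eps; intros y Hy.
  eapply Rle_lt_trans; [apply clamp_lipschitz | exact Hy].
Qed.

Lemma C0_closed_locally (r1 r2 : R) (f : R -> R -> R) :
  C0_closed r1 r2 f <->
  forall r theta, r1 <= r <= r2 -> forall eps : posreal,
    locally_2d (fun u v => r1 <= u <= r2 -> Rabs (f u v - f r theta) < eps) r theta.
Proof.
  split; intros Hf.
  - intros r theta Hr eps.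
    apply locally_2d_locally.
    exact (Hf (r, theta) Hr _ (locally_ball (f r theta) eps)).
  - intros [r theta] Hr P [eps HP]; simpl in Hr.
    specialize (Hf r theta Hr eps).
    apply locally_2d_locally in Hf.
    unfold filtermap, within; revert Hf; apply filter_imp.
    intros [u v] Huv Hu; apply HP, Huv, Hu.
Qed.

Lemma C0_closed_clamp (r1 r2 : R) (f : R -> R -> R) :
  r1 <= r2 -> C0_closed r1 r2 f ->
  forall r theta, continuity_2d_pt (fun u v => f (clamp r1 r2 u) v) r theta.
Proof.
  intros H12 Hf r theta eps.
  destruct (proj1 (C0_closed_locally r1 r2 f) Hf _ theta (clamp_in r1 r2 r H12) eps)
    as [d Hd].
  exists d; intros u v Hu Hv; apply Hd; [ | exact Hv | now apply clamp_in].
  eapply Rle_lt_trans; [apply clamp_lipschitz | exact Hu].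
Qed.

Lemma C0_closed_mult_r (r1 r2 : R) (f : R -> R -> R) :
  r1 <= r2 -> C0_closed r1 r2 f -> C0_closed r1 r2 (fun r theta => r * f r theta).
Proof.
  intros H12 Hf; apply C0_closed_locally; intros r theta Hr eps.
  assert (H : continuity_2d_pt (fun u v => u * f (clamp r1 r2 u) v) r theta).
  { apply continuity_2d_pt_mult; [apply continuity_2d_pt_id1 | ].
    now apply C0_closed_clamp. }
  specialize (H eps); revert H; apply locally_2d_impl, locally_2d_forall.
  intros u v H Hu; now rewrite !clamp_id in H.
Qed.

Lemma extension_unique (r1 r2 : R) (f g h : R -> R -> R) :
  r1 < r2 -> extends_to r1 r2 f g -> extends_to r1 r2 f h ->
  forall r theta, r1 <= r <= r2 -> g r theta = h r theta.
Proof.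
  intros H12 [Hg Hgf] [Hh Hhf] r theta Hr.
  destruct (Req_dec (g r theta) (h r theta)) as [E | E]; [exact E | exfalso].
  assert (He : 0 < Rabs (g r theta - h r theta) / 2)
    by (apply is_pos_div_2 with (eps := mkposreal _ (Rabs_pos_lt _ (Rminus_eq_contra _ _ E)))).
  destruct (proj1 (C0_closed_locally _ _ _) Hg r theta Hr (mkposreal _ He)) as [d1 H1].
  destruct (proj1 (C0_closed_locally _ _ _) Hh r theta Hr (mkposreal _ He)) as [d2 H2].
  simpl in H1, H2.
  assert (Hu : exists u, r1 < u < r2 /\ Rabs (u - r) < d1 /\ Rabs (u - r) < d2).
  (* A step toward the midline of at most a quarter of the width lands in the open strip, where both
     extensions equal [f]. *)
  { set (s := Rmin (Rmin d1 d2) (r2 - r1) / 4).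
    assert (Hs : 0 < s /\ s < d1 /\ s < d2 /\ s <= (r2 - r1) / 4).
    { pose proof (cond_pos d1); pose proof (cond_pos d2).
      unfold s, Rmin; repeat destruct (Rle_dec _ _); lra. }
    destruct (Rle_lt_dec r ((r1 + r2) / 2)).
    - exists (r + s); split; [lra | split; apply Rabs_def1; lra].
    - exists (r - s); split; [lra | split; apply Rabs_def1; lra]. }
  destruct Hu as [u [Hu [Hu1 Hu2]]].
  assert (H0 : forall d : posreal, Rabs (theta - theta) < d)
    by (intros; rewrite Rminus_diag, Rabs_R0; apply cond_pos).
  specialize (H1 u theta Hu1 (H0 d1) ltac:(lra)).
  specialize (H2 u theta Hu2 (H0 d2) ltac:(lra)).
  rewrite Hgf in H1 by lra; rewrite Hhf in H2 by lra.
  revert H1 H2; unfold Rabs; repeat destruct (Rcase_abs _); lra.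
Qed.

Lemma d_r_ext (r1 r2 : R) (f g : R -> R -> R) :
  (forall r theta, r1 < r < r2 -> f r theta = g r theta) ->
  forall r theta, r1 < r < r2 -> d_r f r theta = d_r g r theta.
Proof.
  intros E r theta Hr; apply Derive_ext_loc.
  generalize (locally_2d_1d_const_y _ _ _ (open_strip r1 r2 r theta Hr)).
  apply filter_imp; intros t Ht; now apply E.
Qed.

Lemma d_theta_ext (r1 r2 : R) (f g : R -> R -> R) :
  (forall r theta, r1 < r < r2 -> f r theta = g r theta) ->
  forall r theta, r1 < r < r2 -> d_theta f r theta = d_theta g r theta.
Proof. intros E r theta Hr; apply Derive_ext; intros; now apply E. Qed.

Lemma C2_open_ext (r1 r2 : R) (f g : R -> R -> R) :
  (forall r theta, r1 < r < r2 -> f r theta = g r theta) ->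
  C2_open r1 r2 f -> C2_open r1 r2 g.
Proof.
  intros E Hf r theta Hr; apply ex_diff_n_ext_loc with f; [ | now apply Hf].
  apply locally_2d_impl with (2 := open_strip r1 r2 r theta Hr).
  apply locally_2d_forall; intros; now apply E.
Qed.

Lemma polar_laplace_ext (r1 r2 : R) (f g : R -> R -> R) :
  (forall r theta, r1 < r < r2 -> f r theta = g r theta) ->
  polar_laplace r1 r2 f -> polar_laplace r1 r2 g.
Proof.
  intros E Hf r theta Hr.
  rewrite <- (d_r_ext r1 r2 (d_r f) (d_r g)) by (trivial; now apply d_r_ext).
  rewrite <- (d_theta_ext r1 r2 (d_theta f) (d_theta g)) by (trivial; now apply d_theta_ext).
  rewrite <- (d_r_ext r1 r2 f g) by trivial.
  now apply Hf.
Qed.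

Lemma C2_open_partials (r1 r2 : R) (f : R -> R -> R) (r theta : R) :
  C2_open r1 r2 f -> r1 < r < r2 ->
  (has_partials f (d_r f) (d_theta f) r theta /\
   has_partials (d_r f) (d_r (d_r f)) (d_theta (d_r f)) r theta /\
   has_partials (d_theta f) (d_r (d_theta f)) (d_theta (d_theta f)) r theta) /\
  (continuity_2d_pt f r theta /\ continuity_2d_pt (d_r f) r theta /\
   continuity_2d_pt (d_theta f) r theta) /\
  (continuity_2d_pt (d_r (d_r f)) r theta /\ continuity_2d_pt (d_theta (d_r f)) r theta /\
   continuity_2d_pt (d_r (d_theta f)) r theta /\
   continuity_2d_pt (d_theta (d_theta f)) r theta).
Proof.
  intros Hf Hr; specialize (Hf r theta Hr).
  destruct Hf as [c0 [er [et [[c1 [e11 [e12 [[c11 _] [c12 _]]]]]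
                              [c2 [e21 [e22 [[c21 _] [c22 _]]]]]]]]].
  refine (conj (conj (conj _ _) (conj (conj _ _) (conj _ _)))
            (conj (conj _ (conj _ _)) (conj _ (conj _ (conj _ _)))));
    try assumption; now apply Derive_correct.
Qed.

(** [ex_diff_n] speaks of iterated [Derive], which equals the given partials only on the open strip;
    since the strip is open, this local agreement is enough at every order. *)
Lemma C2_open_of_partials (r1 r2 : R) (f fr ft frr frt ftr ftt : R -> R -> R) :
  (forall r theta, r1 < r < r2 ->
     (has_partials f fr ft r theta /\ has_partials fr frr frt r theta /\
      has_partials ft ftr ftt r theta) /\
     (continuity_2d_pt f r theta /\ continuity_2d_pt fr r theta /\
      continuity_2d_pt ft r theta) /\
     (continuity_2d_pt frr r theta /\ continuity_2d_pt frt r theta /\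
      continuity_2d_pt ftr r theta /\ continuity_2d_pt ftt r theta)) ->
  C2_open r1 r2 f /\
  (forall r theta, r1 < r < r2 ->
     d_r f r theta = fr r theta /\ d_r (d_r f) r theta = frr r theta /\
     d_theta (d_theta f) r theta = ftt r theta).
Proof.
  intros H.
  assert (X : forall f fr ft, (forall r theta, r1 < r < r2 -> has_partials f fr ft r theta) ->
            (forall r theta, r1 < r < r2 -> d_r f r theta = fr r theta) /\
            (forall r theta, r1 < r < r2 -> d_theta f r theta = ft r theta)).
  { intros g gr gt Hg; split; intros r theta Hr; apply is_derive_unique; now apply Hg. }
  assert (L : forall (g h : R -> R -> R),
            (forall r theta, r1 < r < r2 -> g r theta = h r theta) ->
            forall r theta, r1 < r < r2 -> locally_2d (fun u v => h u v = g u v) r theta).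
  { intros g h E r theta Hr.
    apply locally_2d_impl with (2 := open_strip r1 r2 r theta Hr).
    apply locally_2d_forall; intros; symmetry; now apply E. }
  destruct (X f fr ft) as [E1 E2]; [intros; now apply H | ].
  destruct (X fr frr frt) as [E11 E12]; [intros; now apply H | ].
  destruct (X ft ftr ftt) as [E21 E22]; [intros; now apply H | ].
  split.
  - intros r theta Hr.
    destruct (H r theta Hr) as [[H0 [H1 H2]] [[c0 [c1 c2]] [c11 [c12 [c21 c22]]]]].
    split; [exact c0 | split; [eexists; apply H0 | split; [eexists; apply H0 | split]]].
    + apply (ex_diff_n_ext_loc fr _ _ _ _ (L _ _ E1 r theta Hr)).
      split; [exact c1 | split; [eexists; apply H1 | split; [eexists; apply H1 | split]]].
      * split; [exact (continuity_2d_pt_ext_loc frr _ _ _ (L _ _ E11 r theta Hr) c11) | easy].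
      * split; [exact (continuity_2d_pt_ext_loc frt _ _ _ (L _ _ E12 r theta Hr) c12) | easy].
    + apply (ex_diff_n_ext_loc ft _ _ _ _ (L _ _ E2 r theta Hr)).
      split; [exact c2 | split; [eexists; apply H2 | split; [eexists; apply H2 | split]]].
      * split; [exact (continuity_2d_pt_ext_loc ftr _ _ _ (L _ _ E21 r theta Hr) c21) | easy].
      * split; [exact (continuity_2d_pt_ext_loc ftt _ _ _ (L _ _ E22 r theta Hr) c22) | easy].
  - intros r theta Hr; split; [now apply E1 | split].
    + rewrite <- E11 by exact Hr; now apply (d_r_ext r1 r2).
    + rewrite <- E22 by exact Hr; now apply (d_theta_ext r1 r2).
Qed.

(* The jet of [f (exp x) y]: with [x = ln r] the polar Laplace equation becomes the
   Cartesian one. *)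
Definition jet_exp (f : R -> R -> R) : jet :=
  Jet (fun x y => f (exp x) y) (fun x y => exp x * d_r f (exp x) y)
    (fun x y => d_theta f (exp x) y)
    (fun x y => exp x * d_r f (exp x) y + exp x * (exp x * d_r (d_r f) (exp x) y))
    (fun x y => exp x * d_theta (d_r f) (exp x) y)
    (fun x y => exp x * d_r (d_theta f) (exp x) y)
    (fun x y => d_theta (d_theta f) (exp x) y).

Lemma continuity_2d_pt_of_1d (h : R -> R) (x y : R) :
  continuity_pt h x -> continuity_2d_pt (fun u _ => h u) x y.
Proof.
  intros Hh; apply (continuity_1d_2d_pt_comp h (fun u _ => u)); [exact Hh | ].
  apply continuity_2d_pt_id1.
Qed.

Lemma harmonic_exp (r1 r2 : R) (f : R -> R -> R) (x y : R) :
  C2_open r1 r2 f -> polar_laplace r1 r2 f -> r1 < exp x < r2 ->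
  harmonic_at (jet_exp f) x y.
Proof.
  intros Hf Hl Hx; specialize (Hl (exp x) y Hx).
  destruct (C2_open_partials r1 r2 f (exp x) y Hf Hx)
    as [[[] [[] []]] [[? [? ?]] [? [? [? ?]]]]].
  assert (Ce : forall x y, continuity_2d_pt (fun u _ => exp u) x y)
    by (intros; apply continuity_2d_pt_of_1d, derivable_continuous_pt, derivable_pt_exp).
  assert (C : forall g, continuity_2d_pt g (exp x) y ->
            continuity_2d_pt (fun u v => g (exp u) v) x y).
  { intros g Hg; apply (continuity_2d_pt_comp g (fun u _ => exp u) (fun _ v => v));
      [exact Hg | apply Ce | apply continuity_2d_pt_id2]. }
  assert (CM : forall g, continuity_2d_pt g x y ->
            continuity_2d_pt (fun u v => exp u * g u v) x y)
    by (intros; now apply continuity_2d_pt_mult).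
  assert (D : forall g l, is_derive (fun t => g t y) (exp x) l ->
            is_derive (fun t => g (exp t) y) x (exp x * l)).
  { intros g l Hg; apply (is_derive_comp (fun t => g t y) exp); [exact Hg | ].
    apply is_derive_Reals, derivable_pt_lim_exp. }
  split; try split; cbn [val dx dy dxx dxy dyx dyy jet_exp]; auto.
  - apply (is_derive_mult exp (fun t => d_r f (exp t) y) x (exp x)
             (exp x * d_r (d_r f) (exp x) y)).
    + apply is_derive_Reals, derivable_pt_lim_exp.
    + now apply D.
    + intros; apply Rmult_comm.
  - now apply is_derive_scal.
  - apply continuity_2d_pt_plus; auto.
  - pose proof (exp_pos x).
    (* The Cartesian Laplacian is [exp x ^ 2] times the polar one. *)
    replace (_ + _) with (exp x ^ 2 *
      (d_r (d_r f) (exp x) y + / exp x * d_r f (exp x) y +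
       / exp x ^ 2 * d_theta (d_theta f) (exp x) y)) by (field; lra).
    rewrite Hl; ring.
Qed.

Lemma polar_of_harmonic (r1 r2 : R) (k : jet) :
  0 < r1 ->
  (forall x y, ln r1 < x < ln r2 -> harmonic_at k x y) ->
  C2_open r1 r2 (fun r theta => val k (ln r) theta) /\
  polar_laplace r1 r2 (fun r theta => val k (ln r) theta).
Proof.
  intros H1 Hk.
  assert (Hln : forall r, r1 < r < r2 -> ln r1 < ln r < ln r2)
    by (intros r Hr; split; apply ln_increasing; lra).
  destruct (C2_open_of_partials r1 r2 (fun r theta => val k (ln r) theta)
              (fun r theta => / r * dx k (ln r) theta) (fun r theta => dy k (ln r) theta)
              (fun r theta => - / r ^ 2 * dx k (ln r) theta
                              + / r * (/ r * dxx k (ln r) theta))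
              (fun r theta => / r * dxy k (ln r) theta)
              (fun r theta => / r * dyx k (ln r) theta)
              (fun r theta => dyy k (ln r) theta)) as [HC HD].
  - intros r theta Hr.
    destruct (Hk (ln r) theta (Hln r Hr)) as [[] [] [] ? ? ? ? ? ? ? _].
    assert (C : forall g, continuity_2d_pt g (ln r) theta ->
              continuity_2d_pt (fun u v => g (ln u) v) r theta).
    { intros g Hg; apply (continuity_2d_pt_comp g (fun u _ => ln u) (fun _ v => v));
        [exact Hg | | apply continuity_2d_pt_id2].
      apply continuity_2d_pt_of_1d, derivable_continuous_pt.
      exists (/ r); apply derivable_pt_lim_ln; lra. }
    assert (CM : forall g, continuity_2d_pt g r theta ->
              continuity_2d_pt (fun u v => / u * g u v) r theta).
    { intros g Hg; apply continuity_2d_pt_mult; [ | exact Hg].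
      apply continuity_2d_pt_inv; [apply continuity_2d_pt_id1 | lra]. }
    assert (D : forall g l, is_derive (fun t => g t theta) (ln r) l ->
              is_derive (fun t => g (ln t) theta) r (/ r * l)).
    { intros g l Hg; apply (is_derive_comp (fun t => g t theta) ln); [exact Hg | ].
      apply is_derive_Reals, derivable_pt_lim_ln; lra. }
    refine (conj (conj (conj _ _) (conj (conj _ _) (conj _ _)))
              (conj (conj _ (conj _ _)) (conj _ (conj _ (conj _ _))))); auto.
    + apply (is_derive_mult Rinv (fun t => dx k (ln t) theta) r (- / r ^ 2)
               (/ r * dxx k (ln r) theta)).
      * auto_derive; [lra | field; lra].
      * now apply D.
      * intros; apply Rmult_comm.
    + now apply is_derive_scal.
    + apply continuity_2d_pt_plus; auto.
      apply continuity_2d_pt_mult; auto.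
      apply continuity_2d_pt_opp, continuity_2d_pt_inv; [ | simpl; nra].
      apply (continuity_2d_pt_of_1d (fun u => u ^ 2)), derivable_continuous_pt; reg.
  - split; [exact HC | ].
    intros r theta Hr; destruct (HD r theta Hr) as [-> [-> ->]].
    replace (_ + _) with (/ r ^ 2 * (dxx k (ln r) theta + dyy k (ln r) theta))
      by (field; lra).
    rewrite (laplace k) by (apply Hk, Hln, Hr); ring.
Qed.

(** * Dirichlet solutions: uniqueness and construction from Neumann solutions *)

Lemma dirichlet_comparison (r1 r2 : R) (phi u v : R -> R -> R) :
  0 < r1 -> r1 < r2 ->
  dirichlet_solution r1 r2 phi u -> dirichlet_solution r1 r2 phi v ->
  forall r theta, r1 <= r <= r2 -> u r theta <= v r theta.
Proof.
  intros H1 H12 [Cu [Du [Pu [Lu Bu]]]] [Cv [Dv [Pv [Lv Bv]]]] r theta Hr.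
  (* Clamping keeps the difference continuous across [x = ln r1] and [x = ln r2], where [u] and [v]
     are controlled from one side only. *)
  set (c := fun x => clamp r1 r2 (exp x)).
  assert (Hc : forall x, r1 <= c x <= r2) by (intros; apply clamp_in; lra).
  set (f := fun x y => u (c x) y - v (c x) y).
  assert (Hf : f (ln r) theta <= 0).
  { apply (maximum_principle_periodic (jet_lin 1 (jet_exp u) (-1) (jet_exp v)) f
             (ln r1) (ln r2) (2 * PI)).
    - pose proof PI_RGT_0; lra.
    - intros x y _.
      assert (Ce : continuity_2d_pt (fun x _ => exp x) x y)
        by (apply continuity_2d_pt_of_1d, derivable_continuous_pt, derivable_pt_exp).
      apply continuity_2d_pt_minus.
      + apply (continuity_2d_pt_comp (fun x y => u (clamp r1 r2 x) y) (fun x _ => exp x)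
                 (fun _ y => y)); [apply C0_closed_clamp | | apply continuity_2d_pt_id2];
          trivial; lra.
      + apply (continuity_2d_pt_comp (fun x y => v (clamp r1 r2 x) y) (fun x _ => exp x)
                 (fun _ y => y)); [apply C0_closed_clamp | | apply continuity_2d_pt_id2];
          trivial; lra.
    - intros x y _; unfold f; rewrite Pu, Pv by apply Hc; reflexivity.
    - intros x y Hx.
      assert (He : r1 < exp x < r2).
      { rewrite <- (exp_ln r1), <- (exp_ln r2) by lra; split; apply exp_increasing; lra. }
      split.
      + unfold f, c; rewrite clamp_id by lra; simpl; ring.
      + apply harmonic_lin; now apply harmonic_exp with r1 r2.
    - intros x y [-> | ->]; unfold f, c; rewrite exp_ln, clamp_id by lra;
        rewrite Bu, Bv by tauto; lra.
    - split; apply ln_le; lra. }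
  unfold f, c in Hf; rewrite exp_ln, clamp_id in Hf by lra; lra.
Qed.

Lemma dirichlet_unique (r1 r2 : R) (phi u v : R -> R -> R) :
  0 < r1 -> r1 < r2 ->
  dirichlet_solution r1 r2 phi u -> dirichlet_solution r1 r2 phi v ->
  forall r theta, r1 <= r <= r2 -> u r theta = v r theta.
Proof.
  intros H1 H12 Hu Hv r theta Hr; apply Rle_antisym;
    now apply (dirichlet_comparison r1 r2 phi).
Qed.

(** Any extension [Ur] is allowed, so that the lemma serves both the extension hidden in the Neumann
    condition and one given from outside. *)
Lemma dirichlet_of_neumann (r1 r2 : R) (phi U Ur : R -> R -> R) :
  0 < r1 -> r1 < r2 ->
  (forall r theta, r = r1 \/ r = r2 -> phi r (theta + 2 * PI) = phi r theta) ->
  neumann_solution r1 r2 phi U -> extends_to r1 r2 (d_r U) Ur ->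
  dirichlet_solution r1 r2 (fun r theta => r * phi r theta)
    (fun r theta => r * Ur r theta).
Proof.
  intros H1 H12 Hphi [HC2 [_ [HP [HL [Ur' [HU' HB]]]]]] HU.
  (* The Neumann condition is witnessed by its own extension [Ur']; uniqueness of the extension
     transfers the boundary values to [Ur]. *)
  assert (HUB : eq_on_boundary r1 r2 Ur phi).
  { intros r theta Hr; rewrite <- HB by exact Hr.
    apply (extension_unique r1 r2 (d_r U)); trivial; lra. }
  destruct (harmonic_dx (jet_exp U) (ln r1) (ln r2)) as [k Hk].
  { intros x y Hx; apply harmonic_exp with r1 r2; trivial.
    rewrite <- (exp_ln r1), <- (exp_ln r2) by lra; split; apply exp_increasing; lra. }
  destruct (polar_of_harmonic r1 r2 k H1) as [K1 K2]; [intros; now apply Hk | ].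
  assert (E : forall r theta, r1 < r < r2 -> val k (ln r) theta = r * Ur r theta).
  { intros r theta Hr.
    rewrite (proj2 (Hk (ln r) theta ltac:(split; apply ln_increasing; lra))).
    simpl; rewrite exp_ln by lra.
    now rewrite (proj2 HU). }
  split; [exact (C2_open_ext _ _ _ _ E K1) | ].
  split; [apply C0_closed_mult_r; [lra | apply HU] | ].
  split; [ | split; [exact (polar_laplace_ext _ _ _ _ E K2) | ]].
  (* On the boundary periodicity comes from the data, inside from differentiating the periodicity of
     [U] in r. *)
  - intros r theta Hr; f_equal.
    destruct (Req_dec r r1) as [-> | N1]; [now rewrite !HUB, Hphi by tauto | ].
    destruct (Req_dec r r2) as [-> | N2]; [now rewrite !HUB, Hphi by tauto | ].
    rewrite !(proj2 HU) by lra.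
    apply Derive_ext_loc.
    generalize (locally_2d_1d_const_y _ _ _ (open_strip r1 r2 r theta ltac:(lra))).
    apply filter_imp; intros t Ht; apply HP; lra.
  - intros r theta Hr; now rewrite HUB.
Qed.

(** * The integral representation *)

(** The derivative is required only inside the interval, since the radial integral may end on a
    boundary line. Clamping the integrand makes its primitive differentiable everywhere, and [F]
    minus this primitive has zero derivative inside. *)
Lemma RInt_of_derive_interior (F f : R -> R) (a b : R) :
  (forall x, Rmin a b < x < Rmax a b -> is_derive F x (f x)) ->
  (forall x, Rmin a b <= x <= Rmax a b -> continuity_pt F x) ->
  (forall x, Rmin a b <= x <= Rmax a b -> continuity_pt f x) ->
  RInt f a b = F b - F a.
Proof.
  intros HD HF Hf.
  assert (Hab : Rmin a b <= Rmax a b) by apply Rminmax.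
  set (g := fun x => f (clamp (Rmin a b) (Rmax a b) x)).
  assert (Hg : forall x, continuous g x).
  { intros x; apply continuity_pt_filterlim.
    apply (continuity_pt_comp (clamp (Rmin a b) (Rmax a b)) f);
      [apply continuity_pt_clamp | apply Hf, clamp_in, Hab]. }
  assert (HG : forall x, is_derive (fun x => RInt g a x) x (g x)).
  { intros x; apply is_derive_RInt with a; [ | apply Hg].
    apply filter_forall; intros y; apply RInt_correct, ex_RInt_continuous.
    intros; apply Hg. }
  transitivity (RInt g a b).
  { apply RInt_ext; intros x Hx; unfold g; rewrite clamp_id; [reflexivity | lra]. }
  destruct (MVT_gen (fun x => F x - RInt g a x) a b (fun _ => 0)) as [c [_ Hc]].
  - intros x Hx.
    replace 0 with (f x - g x) by (unfold g; rewrite clamp_id by lra; ring).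
    apply (is_derive_minus F (fun x => RInt g a x)); [now apply HD | apply HG].
  - intros x Hx; apply continuity_pt_minus; [now apply HF | ].
    apply derivable_continuous_pt; exists (g x); apply is_derive_Reals, HG.
  - rewrite RInt_point in Hc; unfold zero in Hc; simpl in Hc; lra.
Qed.

Lemma RInt_of_derive (F f : R -> R) (a b : R) :
  (forall x, is_derive F x (f x)) -> (forall x, continuity_pt f x) ->
  RInt f a b = F b - F a.
Proof.
  intros HD Hf; apply RInt_of_derive_interior; auto.
  intros x _; apply derivable_continuous_pt; exists (f x); now apply is_derive_Reals.
Qed.

Lemma continuity_2d_pt_l (f : R -> R -> R) (x y : R) :
  continuity_2d_pt f x y -> continuity_pt (fun t => f t y) x.
Proof.
  intros Hf; apply continuity_pt_locally; intros eps.
  destruct (Hf eps) as [d Hd]; exists d; intros t Ht; apply Hd; [exact Ht | ].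
  rewrite Rminus_diag, Rabs_R0; apply cond_pos.
Qed.

Lemma continuity_2d_pt_r (f : R -> R -> R) (x y : R) :
  continuity_2d_pt f x y -> continuity_pt (fun t => f x t) y.
Proof.
  intros Hf; apply continuity_pt_locally; intros eps.
  destruct (Hf eps) as [d Hd]; exists d; intros t Ht; apply Hd; [ | exact Ht].
  rewrite Rminus_diag, Rabs_R0; apply cond_pos.
Qed.

(** The integrand is the derivative of [rho |-> U (r * rho) theta], because
    [u (r * rho) theta / rho] equals [r * d_r U (r * rho) theta]. For [r < s] the bounds are
    reversed, hence [Rmin] and [Rmax]. *)
Lemma radial_integral (r1 r2 s : R) (U u : R -> R -> R) (r theta : R) :
  0 < r1 -> r1 < s < r2 -> r1 <= r <= r2 ->
  C2_open r1 r2 U -> C0_closed r1 r2 U -> C0_closed r1 r2 u ->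
  (forall r theta, r1 < r < r2 -> u r theta = r * d_r U r theta) ->
  RInt (fun rho => u (r * rho) theta / rho) (s / r) 1 = U r theta - U s theta.
Proof.
  intros H1 Hs Hr HU2 HU Hu E.
  assert (Hsr : 0 < s / r) by (apply Rdiv_lt_0_compat; lra).
  assert (Hpos : forall x, Rmin (s / r) 1 <= x <= Rmax (s / r) 1 -> 0 < x)
    by (intros x; unfold Rmin; destruct (Rle_dec _ _); lra).
  assert (Hin : forall x, Rmin (s / r) 1 <= x <= Rmax (s / r) 1 ->
            Rmin s r <= r * x <= Rmax s r /\
            (Rmin (s / r) 1 < x < Rmax (s / r) 1 -> Rmin s r < r * x < Rmax s r)).
  { assert (Es : s = r * (s / r)) by (field; lra).
    assert (Emin : Rmin s r = r * Rmin (s / r) 1)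
      by (rewrite Rmult_min_distr_l by lra; now rewrite Rmult_1_r, <- Es).
    assert (Emax : Rmax s r = r * Rmax (s / r) 1)
      by (rewrite Rmult_max_distr_l by lra; now rewrite Rmult_1_r, <- Es).
    intros x Hx; rewrite Emin, Emax; split; [ | intros Hx'];
      split; first [apply Rmult_le_compat_l; lra | apply Rmult_lt_compat_l; lra]. }
  assert (Hcl : forall x, Rmin s r <= x <= Rmax s r -> r1 <= x <= r2)
    by (intros x; unfold Rmin, Rmax; repeat destruct (Rle_dec _ _); lra).
  assert (Hop : forall x, Rmin s r < x < Rmax s r -> r1 < x < r2)
    by (intros x; unfold Rmin, Rmax; repeat destruct (Rle_dec _ _); lra).
  assert (Cm : forall g, C0_closed r1 r2 g -> forall x,
            continuity_pt (fun t => g (clamp r1 r2 (r * t)) theta) x).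
  { intros g Hg x.
    apply (continuity_pt_comp (fun t => r * t) (fun t => g (clamp r1 r2 t) theta)); [reg | ].
    apply (continuity_2d_pt_l (fun t y => g (clamp r1 r2 t) y)).
    apply C0_closed_clamp; [lra | exact Hg]. }
  transitivity (RInt (fun rho => u (clamp r1 r2 (r * rho)) theta / rho) (s / r) 1).
  { apply RInt_ext; intros x Hx; rewrite clamp_id; [reflexivity | ].
    apply Hcl, Hin; lra. }
  rewrite (RInt_of_derive_interior (fun t => U (clamp r1 r2 (r * t)) theta)).
  - replace (r * (s / r)) with s by (field; lra); rewrite Rmult_1_r, !clamp_id by lra.
    reflexivity.
  - intros x Hx.
    assert (Hx' : r1 < r * x < r2) by (apply Hop, Hin; lra).
    assert (Hx0 : 0 < x) by (apply Hpos; lra).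
    apply (is_derive_ext_loc (fun t => U (r * t) theta)).
    { destruct (open_strip r1 r2 (r * x) theta Hx') as [d Hd].
      assert (Hd' : 0 < d / r) by (apply Rdiv_lt_0_compat; [apply cond_pos | lra]).
      exists (mkposreal _ Hd'); intros t Ht; simpl in Ht.
      rewrite clamp_id; [reflexivity | ].
      assert (K : r1 < r * t < r2).
      { apply (Hd (r * t) theta); [ | rewrite Rminus_diag, Rabs_R0; apply cond_pos].
        replace (r * t - r * x) with (r * (t - x)) by ring.
        rewrite Rabs_mult, (Rabs_pos_eq r) by lra.
        replace (pos d) with (r * (d / r)) by (field; lra).
        apply Rmult_lt_compat_l; [lra | exact Ht]. }
      lra. }
    rewrite clamp_id by lra; rewrite E by exact Hx'.
    replace (r * x * d_r U (r * x) theta / x) with (r * d_r U (r * x) theta)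
      by (field; lra).
    apply (is_derive_comp (fun t => U t theta) (fun t => r * t)).
    + now apply (C2_open_partials r1 r2 U).
    + auto_derive; [easy | ring].
  - intros x _; now apply Cm.
  - intros x Hx; apply continuity_pt_mult; [now apply Cm | ].
    apply continuity_pt_inv; [reg | ]. specialize (Hpos x Hx); lra.
Qed.

(* With [u = r U_r] the polar Laplace equation reads [U_tt = - r u_r], so [u_r]
   integrates to [U_t] and, by periodicity, [mean_const] is [U_t (s, 0) / s]. *)
Lemma angular_integral (r1 r2 s : R) (U u : R -> R -> R) (theta : R) :
  0 < r1 -> r1 < s < r2 ->
  C2_open r1 r2 U -> periodic_strip r1 r2 U -> polar_laplace r1 r2 U ->
  C2_open r1 r2 u ->
  (forall r theta, r1 < r < r2 -> u r theta = r * d_r U r theta) ->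
  s * RInt (fun t => mean_const s u - RInt (fun tau => d_r u s tau) 0 t) 0 theta
    = U s theta - U s 0.
Proof.
  intros H1 Hs HU HP HL Hu E.
  set (q := d_theta U s).
  assert (Dq : forall t, is_derive q t (- s * d_r u s t)).
  { intros t.
    replace (- s * d_r u s t) with (d_theta (d_theta U) s t);
      [now apply (C2_open_partials r1 r2 U s t HU Hs) | ].
    assert (Eu : d_r u s t = d_r U s t + s * d_r (d_r U) s t).
    { rewrite (d_r_ext r1 r2 u (fun r theta => r * d_r U r theta)) by trivial.
      apply is_derive_unique.
      replace (d_r U s t) with (1 * d_r U s t) at 1 by ring.
      apply (is_derive_mult (fun r => r) (fun r => d_r U r t) s 1 (d_r (d_r U) s t)).
      - apply (is_derive_id (K := R_AbsRing)).
      - now apply (C2_open_partials r1 r2 U s t HU Hs).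
      - intros; apply Rmult_comm. }
    specialize (HL s t Hs); rewrite Eu.
    (* [U_tt] is [s ^ 2] times the polar expression, which vanishes, minus [s * u_r]. *)
    replace (d_theta (d_theta U) s t) with
      (s ^ 2 * (d_r (d_r U) s t + / s * d_r U s t + / s ^ 2 * d_theta (d_theta U) s t)
       - s * (d_r U s t + s * d_r (d_r U) s t)) by (field; lra).
    rewrite HL; ring. }
  assert (DU : forall t, is_derive (U s) t (q t))
    by (intros t; now apply (C2_open_partials r1 r2 U s t HU Hs)).
  assert (Cq : forall t, continuity_pt q t).
  { intros t; apply derivable_continuous_pt; eexists; apply is_derive_Reals, Dq. }
  assert (I1 : forall t, RInt (fun tau => d_r u s tau) 0 t = q 0 / s - q t / s :> R).
  { intros t; rewrite (RInt_of_derive (fun t => - / s * q t)).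
    - field; lra.
    - intros x; replace (d_r u s x) with (- / s * (- s * d_r u s x)) by (field; lra).
      now apply is_derive_scal.
    - intros x; apply (continuity_2d_pt_r (d_r u)).
      now apply (C2_open_partials r1 r2 u s x Hu Hs). }
  assert (Em : mean_const s u = q 0 / s).
  { unfold mean_const.
    rewrite (RInt_ext _ (fun t => q 0 / s - q t / s)) by (intros; apply I1).
    rewrite (RInt_of_derive (fun t => q 0 / s * t + - / s * U s t)).
    (* The third [2 * PI] is the argument of [U s]: periodicity cancels the increment of [U s], and
       only the constant [q 0 / s] survives in the mean. *)
    - rewrite <- (Rplus_0_l (2 * PI)) at 3; rewrite HP by lra.
      pose proof PI_RGT_0; field; lra.
    - intros x; replace (q 0 / s - q x / s) with (q 0 / s * 1 + - / s * q x) by (field; lra).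
      apply is_derive_lin; [apply (is_derive_id (K := R_AbsRing)) | apply DU].
    - intros x; apply continuity_pt_minus; [apply continuity_pt_const; easy | ].
      apply continuity_pt_mult; [apply Cq | apply continuity_pt_const; easy]. }
  rewrite (RInt_ext _ (fun t => / s * q t)).
  - rewrite (RInt_of_derive (fun t => / s * U s t)).
    + field; lra.
    + intros x; apply is_derive_scal, DU.
    + intros x; apply continuity_pt_mult; [apply continuity_pt_const; easy | apply Cq].
  - intros x _; change (mean_const s u - RInt (fun tau => d_r u s tau) 0 x = / s * q x :> R).
    rewrite Em, I1; field; lra.
Qed.

Theorem theorem1 :
  forall r1 r2 : R, 0 < r1 -> r1 < r2 ->
  (forall phi : R -> R -> R,
     boundary_data r1 r2 phi ->
     RInt (fun theta => r1 * phi r1 theta) 0 (2 * PI)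
       = RInt (fun theta => r2 * phi r2 theta) 0 (2 * PI) ->
     forall U u : R -> R -> R,
     neumann_solution r1 r2 phi U ->
     U (sqrt (r1 * r2)) 0 = 0 ->
     dirichlet_solution r1 r2 (fun r theta => r * phi r theta) u ->
     forall r theta : R, r1 <= r <= r2 ->
       U r theta =
         RInt (fun rho => u (r * rho) theta / rho) (sqrt (r1 * r2) / r) 1
         + sqrt (r1 * r2) *
           RInt (fun t =>
                   mean_const (sqrt (r1 * r2)) u
                   - RInt (fun tau => d_r u (sqrt (r1 * r2)) tau) 0 t)
                0 theta)
  /\
  (forall phi : R -> R -> R,
     boundary_data r1 r2 phi ->
     RInt (fun theta => phi r1 theta) 0 (2 * PI)
       = RInt (fun theta => phi r2 theta) 0 (2 * PI) ->
     forall U Ur : R -> R -> R,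
     neumann_solution r1 r2 (fun r theta => phi r theta / r) U ->
     extends_to r1 r2 (d_r U) Ur ->
     the_dirichlet_solution r1 r2 phi (fun r theta => r * Ur r theta)).
Proof.
  intros r1 r2 H1 H12; split.
  - intros phi Hphi _ U u HU HU0 Hu r theta Hr.
    assert (Hs : r1 < sqrt (r1 * r2) < r2).
    { split.
      - rewrite <- (sqrt_square r1) at 1 by lra; apply sqrt_lt_1; nra.
      - rewrite <- (sqrt_square r2) at 2 by lra; apply sqrt_lt_1; nra. }
    destruct HU as [HC2 [HC1 [HP [HL [Ur [HUr HB]]]]]].
    assert (E : forall r theta, r1 < r < r2 -> u r theta = r * d_r U r theta).
    { intros x y Hx; rewrite <- (proj2 HUr) by exact Hx.
      apply (dirichlet_unique r1 r2 (fun r theta => r * phi r theta) u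
               (fun r theta => r * Ur r theta)); trivial; [ | lra].
      apply (dirichlet_of_neumann r1 r2 phi U Ur); trivial.
      - intros; now apply Hphi.
      - exact (conj HC2 (conj HC1 (conj HP (conj HL (ex_intro _ Ur (conj HUr HB)))))). }
    destruct Hu as [Cu [Du _]].
    (* The two integrals are the increments of [U] from [(s, theta)] to [(r, theta)] and from
       [(s, 0)] to [(s, theta)], with [s] the geometric mean; the normalization removes [U s 0]. *)
    rewrite (radial_integral r1 r2 _ U u r theta); trivial; [ | apply HC1].
    rewrite (angular_integral r1 r2 _ U u theta); trivial.
    rewrite HU0; ring.
  - intros phi Hphi _ U Ur HU HUr.
    assert (HS : dirichlet_solution r1 r2 phi (fun r theta => r * Ur r theta)).
    { destruct (dirichlet_of_neumann r1 r2 (fun r theta => phi r theta / r) U Ur)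
        as [D1 [D2 [D3 [D4 D5]]]]; trivial.
      - intros r theta Hr; f_equal; now apply Hphi.
      - split; [exact D1 | split; [exact D2 | split; [exact D3 | split; [exact D4 | ]]]].
        intros r theta Hr; rewrite D5 by exact Hr.
        field; destruct Hr; subst; lra. }
    split; [exact HS | ].
    intros v Hv; now apply (dirichlet_unique r1 r2 phi).
Qed.
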